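(* Let $S$ be a densely defined nonnegative symmetric operator in a separable complex Hilbert space $\mathfrak H$, and let $\widetilde S_0,\widetilde S_1$ be two nonnegative selfadjoint extensions of $S$ such that $\operatorname{dom}\widetilde S_1\cap\operatorname{dom}\widetilde S_0=\operatorname{dom}S$ and the form $\widetilde S_0[\cdot,\cdot]$ is a closed restriction of the form $\widetilde S_1[\cdot,\cdot]$. Let $\{\mathcal H,\Gamma_0,\Gamma_1\}$ be a boundary triplet for the pair $\{\widetilde S_0,\widetilde S_1\}$. Then the operator $\widetilde{\mathcal A}$ defined by $$\widetilde{\mathcal A}\begin{pmatrix}u\\ \Gamma_0u\end{pmatrix}=\begin{pmatrix}S^*u\\ -\Gamma_1u\end{pmatrix},\qquad u\in\mathcal L,$$ is a nonnegative selfadjoint extension of $S$ acting in the Hilbert space $\widetilde{\mathfrak H}=\mathfrak H\oplus\mathcal H$. Moreover, $$\mathcal D[\widetilde{\mathcal A}]=\left\{\begin{pmatrix}v\\ \Gamma_0v\end{pmatrix}:\ v\in\mathcal D[\widetilde S_1]\right\},\qquad\widetilde{\mathcal A}\left[\begin{pmatrix}v\\ \Gamma_0v\end{pmatrix}\right]=\widetilde S_1[v],$$ and $\operatorname{dom}\widetilde{\mathcal A}^{1/2}\cap\mathcal H=\{0\}$ holds. If, in addition, the pair $\{\widetilde S_0,\widetilde S_1\}$ satisfies the properties: $\widetilde S_0\cap\widetilde S_1=S$, the form $\widetilde S_0[\cdot,\cdot]$ is a closed restriction of the form $\widetilde S_1[\cdot,\cdot]$, and the form $\widetilde S_1^{-1}[\cdot,\cdot]$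 is a closed restriction of the form $\widetilde S_0^{-1}[\cdot,\cdot]$, then $$\inf_{u\in\operatorname{dom}\widetilde S_0}\widetilde{\mathcal A}\left[\begin{pmatrix}v\\ \Gamma_0v\end{pmatrix}-\begin{pmatrix}u\\0\end{pmatrix}\right]=0\quad\text{for all }v\in\mathcal D[\widetilde S_1]$$ and, moreover, $\operatorname{ran}\widetilde{\mathcal A}^{1/2}\cap\mathcal H=\{0\}$.
   Context: For a nonnegative selfadjoint operator $T$: $\mathcal D[T]=\operatorname{dom}T^{1/2}$, $T[u,v]=(T^{1/2}u,T^{1/2}v)$, $T[u]=T[u,u]$. The inverse $T^{-1}$ is in general a nonnegative selfadjoint linear relation (the inverse of the graph); for a nonnegative selfadjoint relation $R$, $R=R_s\oplus(\{0\}\times\operatorname{mul}R)$ with $\operatorname{mul}R=\{f':\{0,f'\}\in R\}$ and $R_s$ a nonnegative selfadjoint operator in $\overline{\operatorname{dom}}\,R$, its form is $R[u,v]=(R_s^{1/2}u,R_s^{1/2}v)$ on $\mathcal D[R]=\operatorname{dom}R_s^{1/2}$. A form $\mathfrak h_1$ is a closed restriction of $\mathfrak h_2$ if $\operatorname{dom}\mathfrak h_1\subset\operatorname{dom}\mathfrak h_2$ and the (closed) forms agree on $\operatorname{dom}\mathfrak h_1$. The space $\mathcal D[\widetilde S_1]$ is a Hilbert space with inner product $(u,v)_{\widetilde S_1}=\widetilde S_1[u,v]+(u,v)$, and $\mathcal D[\widetilde S_1]\ominus_{\widetilde S_1}\mathcal D[\widetilde S_0]$ denotes the orthogonal complement of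 $\mathcal D[\widetilde S_0]$ in it. The linear manifold $\mathcal L$ is the direct sum $\mathcal L:=\operatorname{dom}\widetilde S_0\dotplus\big(\mathcal D[\widetilde S_1]\ominus_{\widetilde S_1}\mathcal D[\widetilde S_0]\big)$; it satisfies $\mathcal L\subset\mathcal D[\widetilde S_1]\cap\operatorname{dom}S^*$. A boundary pair for $\{\widetilde S_0,\widetilde S_1\}$ is a pair $\{\mathcal H,\Gamma_0\}$ where $\mathcal H$ is a Hilbert space and $\Gamma_0:\mathcal D[\widetilde S_1]\to\mathcal H$ is a continuous linear operator (with respect to $(\cdot,\cdot)_{\widetilde S_1}$) with $\ker\Gamma_0=\mathcal D[\widetilde S_0]$ and $\operatorname{ran}\Gamma_0=\mathcal H$. Given a boundary pair, there is a unique linear operator $\Gamma_1:\mathcal L\to\mathcal H$ such that $\widetilde S_1[u,v]=(S^*u,v)-(\Gamma_1u,\Gamma_0v)_{\mathcal H}$ for all $u\in\mathcal L$, $v\in\mathcal D[\widetilde S_1]$; the triple $\{\mathcal H,\Gamma_0,\Gamma_1\}$ is then called a boundary triplet for the pair $\{\widetilde S_0,\widetilde S_1\}$. The spaces $\mathfrak H$ and $\mathcal H$ are identified with $\mathfrak H\oplus\{0\}$ and $\{0\}\oplus\mathcal H$ in $\widetilde{\mathfrak H}$; ''extension of $S$'' means $\widetilde{\mathcal A}\binom{u}{0}=\binom{Su}{0}$ for $u\in\operatorname{dom}S$. *)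

(* Defs.v *)
From HB Require Import structures.
From mathcomp Require Import all_boot all_order all_algebra.
From mathcomp Require Import sesquilinear.
From mathcomp Require Import all_classical all_reals ereal.
From mathcomp Require Export complex.

Set Implicit Arguments.
Unset Strict Implicit.
Unset Printing Implicit Defensive.

Import Order.TTheory GRing.Theory Num.Theory Num.Def.
Local Open Scope classical_set_scope.
Local Open Scope ring_scope.

Section DotNorm.
Context {R : realType} {U : lmodType R[i]} (form : {dot U for conjC}).

(* [form u u] is a nonnegative element of [R[i]], hence real. *)
Definition dot_norm (u : U) : R := Num.sqrt (complex.Re (form u u)).

Definition dot_cauchy (x : nat -> U) :=
  forall e : R, 0 < e -> exists N : nat, forall m n : nat,
    (N <= m)%N -> (N <= n)%N -> dot_norm (x m - x n) < e.

Definition dot_cvg_to (x : nat -> U) (l : U) :=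
  forall e : R, 0 < e -> exists N : nat, forall n : nat,
    (N <= n)%N -> dot_norm (x n - l) < e.

Definition dot_complete := forall x, dot_cauchy x -> exists l, dot_cvg_to x l.

End DotNorm.

(* Inner products are linear in the first argument and conjugate linear in the
   second one, as in the library's [{dot U for conjC}]. *)
HB.mixin Record Lmodule_isHilbert (R : realType) (H : Type)
    of GRing.Lmodule R[i] H := {
  hdot : {dot H for conjC};
  hdot_complete : dot_complete hdot
}.

#[short(type="hilbertType")]
HB.structure Definition Hilbert (R : realType) :=
  {H of Lmodule_isHilbert R H & GRing.Lmodule R[i] H}.

Arguments hdot {R s}.
Definition hnorm {R : realType} {H : hilbertType R} (u : H) : R :=
  dot_norm hdot u.

Section DirectSum.
Context {R : realType} (H K : hilbertType R).

Definition sum_dot (p q : H * K) : R[i] := hdot p.1 q.1 + hdot p.2 q.2.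

Fact sum_dot_bilinear : bilinear_for
  ( *%R : GRing.Scale.law _ _) (conjC \; *%R : GRing.Scale.law _ _) sum_dot.
Proof.
split=> [q|p] a u v; rewrite /sum_dot /=.
  by rewrite !linearPl mulrDr addrACA.
by rewrite !linearPr mulrDr addrACA.
Qed.

HB.instance Definition _ := @bilinear_isBilinear.Build
  R[i] (H * K)%type (H * K)%type R[i] *%R (conjC \; *%R) sum_dot
  sum_dot_bilinear.

Fact sum_dot_hermitian (p q : H * K) :
  sum_dot p q = (-1) ^+ false * conjC (sum_dot q p).
Proof.
rewrite /sum_dot rmorphD/= expr0 mul1r.
by rewrite [hdot p.1 _]hermC [hdot p.2 _]hermC /= expr0 !mul1r.
Qed.

HB.instance Definition _ := isHermitianSesquilinear.Build
  R[i] (H * K)%type false conjC sum_dot sum_dot_hermitian.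

Fact sum_dot_gt0 (p : H * K) : p != 0 -> 0 < sum_dot p p.
Proof.
move=> p0; rewrite /sum_dot lt_def addr_ge0 ?dnorm_ge0 // andbT.
rewrite paddr_eq0 ?dnorm_ge0 // !dnorm_eq0; apply: contra p0.
by case: p => a b /= /andP[/eqP-> /eqP->].
Qed.

HB.instance Definition _ := isDotProduct.Build
  R[i] (H * K)%type sum_dot sum_dot_gt0.

Fact sum_dot_complete : dot_complete sum_dot.
Proof.
have ReD (a b : R[i]) : complex.Re (a + b) = complex.Re a + complex.Re b.
  by case: a; case: b.
have Re0 (V : hilbertType R) (v : V) : 0 <= complex.Re (hdot v v).
  by have := dnorm_ge0 hdot v; rewrite lecE => /andP[].
have sumE (p : H * K) : dot_norm sum_dot p =
    Num.sqrt (hnorm p.1 ^+ 2 + hnorm p.2 ^+ 2).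
  by rewrite /hnorm /dot_norm !sqr_sqrtr ?Re0 // -ReD.
have le1 (p : H * K) : hnorm p.1 <= dot_norm sum_dot p.
  by rewrite sumE -[leLHS]ger0_norm ?sqrtr_ge0 // -sqrtr_sqr ler_wsqrtr //
    lerDl sqr_ge0.
have le2 (p : H * K) : hnorm p.2 <= dot_norm sum_dot p.
  by rewrite sumE -[leLHS]ger0_norm ?sqrtr_ge0 // -sqrtr_sqr ler_wsqrtr //
    lerDr sqr_ge0.
have le12 (p : H * K) : dot_norm sum_dot p <= hnorm p.1 + hnorm p.2.
  have h1 : 0 <= hnorm p.1 by exact: sqrtr_ge0.
  have h2 : 0 <= hnorm p.2 by exact: sqrtr_ge0.
  rewrite sumE -[leRHS]ger0_norm ?addr_ge0 // -sqrtr_sqr ler_wsqrtr //.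
  by rewrite sqrrD lerD2r lerDl mulrn_wge0 // mulr_ge0.
move=> x cx.
have [|l1 hl1] := @hdot_complete R H (fun n => (x n).1).
  move=> e e0; have [N hN] := cx e e0; exists N => m n Nm Nn.
  by apply: le_lt_trans (hN m n Nm Nn); exact: (le1 (x m - x n)).
have [|l2 hl2] := @hdot_complete R K (fun n => (x n).2).
  move=> e e0; have [N hN] := cx e e0; exists N => m n Nm Nn.
  by apply: le_lt_trans (hN m n Nm Nn); exact: (le2 (x m - x n)).
exists (l1, l2) => e e0.
have e2 : 0 < e / 2 by rewrite divr_gt0.
have [N1 hN1] := hl1 _ e2; have [N2 hN2] := hl2 _ e2.
exists (maxn N1 N2) => n; rewrite geq_max => /andP[n1 n2].
apply: le_lt_trans (le12 _) _; rewrite [e]splitr ltrD //.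
  exact: hN1.
exact: hN2.
Qed.

HB.instance Definition _ := Lmodule_isHilbert.Build R (H * K)%type
  sum_dot_complete.

End DirectSum.

Section Topology.
Context {R : realType} {H : hilbertType R}.

Definition hclosure (M : set H) : set H :=
  [set u | forall e : R, 0 < e -> exists2 v, M v & hnorm (u - v) < e].

Definition hdense (M : set H) := hclosure M = [set: H].

End Topology.

Definition separable {R : realType} (H : hilbertType R) :=
  exists2 D : set H, countable D & hdense D.

(* Possibly unbounded, not everywhere defined operators, and linear relations,
   are represented by their graphs. *)
Section Relations.
Context {R : realType} {H K : hilbertType R}.
Implicit Type T : set (H * K).

Definition linear_relation T :=
  T (0, 0) /\ forall (a : R[i]) p q, T p -> T q -> T (a *: p + q).

Definition dom T : set H := fst @` T.
Definition ran T : set K := snd @` T.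
Definition mul T : set K := [set f | T (0, f)].
Definition inverse T : set (K * H) := [set p | T (p.2, p.1)].

Definition linear_operator T := linear_relation T /\ mul T = [set 0].

(* The value of the operator with graph [T] at [u \in dom T]; 0 elsewhere. *)
Definition value T (u : H) : K := xget 0 [set w | T (u, w)].

Definition adjoint T : set (K * H) :=
  [set p | forall q, T q -> hdot q.2 p.1 = hdot q.1 p.2].

End Relations.

Section Endorelations.
Context {R : realType} {H : hilbertType R}.
Implicit Types (T B : set (H * H)) (M : set H).

Definition symmetric_relation T := T `<=` adjoint T.

Definition nonnegative T := forall p, T p -> 0 <= hdot p.2 p.1.

(* Selfadjointness in the subspace [M], regarded as a Hilbert space itself. *)
Definition selfadjoint_in M T := T = adjoint T `&` (M `*` M).

Definition selfadjoint T := T = adjoint T.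

Definition nonneg_selfadjoint_operator T :=
  [/\ linear_operator T, nonnegative T & selfadjoint T].

Definition comp_relation T B : set (H * H) :=
  [set p | exists2 w, B (p.1, w) & T (w, p.2)].

Definition is_sqrt_in M T B :=
  [/\ linear_operator B, nonnegative B, selfadjoint_in M B
    & comp_relation B B = T].

(* The nonnegative selfadjoint square root of [T] in the closed subspace [M]. It
   exists and is unique when [T] is a nonnegative selfadjoint operator in [M]. *)
Definition sqrt_in M T : set (H * H) := xget set0 [set B | is_sqrt_in M T B].

Definition sqrt_op T := sqrt_in setT T.

Record qform := QForm { qdom : set H ; qval : H -> H -> R[i] }.

Definition form_of_sqrt B : qform :=
  QForm (dom B) (fun u v => hdot (value B u) (value B v)).

Definition form_op T : qform := form_of_sqrt (sqrt_op T).

Definition op_part T : set (H * H) :=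
  [set p | T p /\ forall m, mul T m -> hdot p.2 m = 0].

Definition form_rel T : qform :=
  form_of_sqrt (sqrt_in (hclosure (dom T)) (op_part T)).

(* Only used for forms [form_op T] and [form_rel T], which are closed. *)
Definition closed_restriction (h1 h2 : qform) :=
  qdom h1 `<=` qdom h2 /\
  forall u v, qdom h1 u -> qdom h1 v -> qval h1 u v = qval h2 u v.

Definition form_dot (h : qform) (u v : H) : R[i] := qval h u v + hdot u v.

Definition form_norm (h : qform) (u : H) : R :=
  Num.sqrt (complex.Re (form_dot h u u)).

Definition form_ominus (h1 h0 : qform) : set H :=
  [set w | qdom h1 w /\ forall v, qdom h0 v -> form_dot h1 w v = 0].

End Endorelations.

Arguments qform {R} H.

(* [Gamma0] and [Gamma1] are given by total functions, of which only the values
   on [D[S1]], respectively on [calL S0 S1], matter. *)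
Section BoundaryTriplets.
Context {R : realType} {H K : hilbertType R}.

Definition linear_on (D : set H) (f : H -> K) :=
  forall (a : R[i]) u v, D u -> D v -> f (a *: u + v) = a *: f u + f v.

Definition form_continuous (h : qform H) (f : H -> K) :=
  forall v, qdom h v -> forall e : R, 0 < e ->
  exists2 d : R, 0 < d & forall w, qdom h w ->
    form_norm h (w - v) < d -> hnorm (f w - f v) < e.

Definition calL (S0 S1 : set (H * H)) : set H :=
  [set u | exists2 u0, dom S0 u0
         & exists2 w, form_ominus (form_op S1) (form_op S0) w & u = u0 + w].

Definition boundary_pair (S0 S1 : set (H * H)) (Gamma0 : H -> K) :=
  let D1 := qdom (form_op S1) in
  [/\ linear_on D1 Gamma0,
      form_continuous (form_op S1) Gamma0,
      [set v | D1 v /\ Gamma0 v = 0] = qdom (form_op S0)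
    & Gamma0 @` D1 = setT].

Definition boundary_triplet (S S0 S1 : set (H * H)) (Gamma0 Gamma1 : H -> K) :=
  [/\ boundary_pair S0 S1 Gamma0,
      linear_on (calL S0 S1) Gamma1
    & forall u v, calL S0 S1 u -> qdom (form_op S1) v ->
        qval (form_op S1) u v =
          hdot (value (adjoint S) u) v - hdot (Gamma1 u) (Gamma0 v)].

Definition calA (S S0 S1 : set (H * H)) (Gamma0 Gamma1 : H -> K) :
    set ((H * K) * (H * K)) :=
  [set ((u, Gamma0 u), (value (adjoint S) u, - Gamma1 u)) | u in calL S0 S1].

End BoundaryTriplets.

(* Main.v *)
(* With [B1 = S1^(1/2)] and the closed operator
   [couple : (v, Gamma0 v) |-> B1 v], one has [calA = couple^* couple], which
   makes [calA] nonnegative and selfadjoint with form [|couple p|^2]: the domain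
   of [couple^* couple] is a core of [couple], so that any square root of [calA]
   has the domain and the norms of [couple].

   For the second part, take [x] in [dom S1], [h = B1 x] and [f = S1 x]. The
   hypothesis on the inverse forms yields [h'] with [S0^(1/2) h' = f] and
   [|h'| = |h|], lying in the closure of [ran S0^(1/2)]. For [u] in [dom S0],
   [(h, B1 u) = (f, u) = (h', S0^(1/2) u)] and [|B1 u| = |S0^(1/2) u|], hence
   [|h - B1 u| = |h' - S0^(1/2) u|], which can be made small. *)
Require Import Defs.
From HB Require Import structures.
From mathcomp Require Import all_boot all_order all_algebra.
From mathcomp Require Import sesquilinear.
From mathcomp Require Import all_classical all_reals ereal.
From mathcomp Require Import ring lra.

Set Implicit Arguments.
Unset Strict Implicit.
Unset Printing Implicit Defensive.

Import Order.TTheory GRing.Theory Num.Theory Num.Def.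
Local Open Scope classical_set_scope.
Local Open Scope ring_scope.

(** * Orthogonal projections *)

(** Forms are defined through a square root selected by [xget], so nothing is known about it until
    some square root is shown to exist, and uniqueness is never proved. For [S0] and [S1] existence
    is read off the boundary pair: [Gamma0] is onto with kernel [D[S0]], whereas the default value
    of [xget] would leave the form domains empty. For [calA] a square root is constructed without
    spectral theory, from the bounded resolvent [(1 + T)^-1] and an iteration with an explicit rate.
    For the inverse relations, the square roots of [S0] and [S1] are inverted off the kernel.
    Surjectivity of [1 + G^* G], obtained by projecting [(f, 0)] onto the graph of [G], is behind
    both the selfadjointness of [calA] and the core property.

    [calL] emerges from [couple^* couple] because [v] in [D[S1]] splits orthogonally along [D[S0]],
    and the adjoint equation tested on [D[S0]] forces the first part into [dom S0]. *)

Lemma ReD (R : realType) (a b : R[i]) :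
  complex.Re (a + b) = complex.Re a + complex.Re b.
Proof. by case: a; case: b. Qed.

Lemma ReB (R : realType) (a b : R[i]) :
  complex.Re (a - b) = complex.Re a - complex.Re b.
Proof. by case: a; case: b. Qed.

Lemma Re_conjC (R : realType) (a : R[i]) : complex.Re (conjC a) = complex.Re a.
Proof. by case: a. Qed.

Lemma Re_mulr (R : realType) (r : R) (b : R[i]) :
  complex.Re (r%:C%C * b) = r * complex.Re b.
Proof. by case: b => x y /=; rewrite mul0r subr0. Qed.

Lemma normCK_Re (R : realType) (a : R[i]) :
  complex.Re (conjC a * a) = 0 -> a = 0.
Proof.
case: a => x y /= h; apply/eqP; rewrite eq_complex /=.
have : x ^+ 2 + y ^+ 2 = 0 by rewrite -[RHS]h; ring.
by move/eqP; rewrite paddr_eq0 ?sqr_ge0 // !sqrf_eq0.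
Qed.

Lemma invn_small (R : realType) (e : R) : 0 < e ->
  exists N : nat, forall n, (N <= n)%N -> n.+1%:R^-1 < e.
Proof.
move=> /ltr_add_invr[N]; rewrite add0r => hN; exists N => n Nn.
by apply: le_lt_trans hN; rewrite lef_pV2 ?posrE ?ltr0Sn // ler_nat ltnS.
Qed.

Section Hilbert.
Context {R : realType} {H : hilbertType R}.
Implicit Types (u v w x y z : H) (a b : R[i]) (M : set H).

Lemma dotC u v : hdot u v = conjC (hdot v u).
Proof. by rewrite hermC /= expr0 mul1r. Qed.

Lemma dot_eq0C u v : hdot u v = 0 -> hdot v u = 0.
Proof. by move=> h; rewrite dotC h conjC0. Qed.

Lemma dotDl u v w : hdot (u + v) w = hdot u w + hdot v w.
Proof. exact: linearDl. Qed.
Lemma dotDr u v w : hdot w (u + v) = hdot w u + hdot w v.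
Proof. exact: linearDr. Qed.
Lemma dotBl u v w : hdot (u - v) w = hdot u w - hdot v w.
Proof. exact: linearBl. Qed.
Lemma dotBr u v w : hdot w (u - v) = hdot w u - hdot w v.
Proof. exact: linearBr. Qed.
Lemma dotNl u w : hdot (- u) w = - hdot u w.
Proof. exact: linearNl. Qed.
Lemma dotNr u w : hdot w (- u) = - hdot w u.
Proof. exact: linearNr. Qed.
Lemma dot0l w : hdot 0 w = 0.
Proof. exact: linear0l. Qed.
Lemma dot0r w : hdot w 0 = 0.
Proof. exact: linear0r. Qed.
Lemma dotZl a u w : hdot (a *: u) w = a * hdot u w.
Proof. exact: linearZl_LR. Qed.
Lemma dotZr a u w : hdot w (a *: u) = conjC a * hdot w u.
Proof. exact: linearZr_LR. Qed.

Lemma dotZr_real (r : R) u w : hdot w (r%:C%C *: u) = r%:C%C * hdot w u.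
Proof.
rewrite dotZr; congr (_ * _); apply/eqP.
by rewrite eq_complex /= oppr0 !eqxx.
Qed.

(** Estimates are carried out in the underlying real inner product space, where they are polynomial
    inequalities; [orth_rdot] and [normCK_Re] lead back to the complex product. *)
Definition rdot u v : R := complex.Re (hdot u v).

Lemma rdotC u v : rdot u v = rdot v u.
Proof. by rewrite /rdot dotC Re_conjC. Qed.
Lemma rdotDl u v w : rdot (u + v) w = rdot u w + rdot v w.
Proof. by rewrite /rdot dotDl ReD. Qed.
Lemma rdotDr u v w : rdot w (u + v) = rdot w u + rdot w v.
Proof. by rewrite /rdot dotDr ReD. Qed.
Lemma rdotBl u v w : rdot (u - v) w = rdot u w - rdot v w.
Proof. by rewrite /rdot dotBl ReB. Qed.
Lemma rdotBr u v w : rdot w (u - v) = rdot w u - rdot w v.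
Proof. by rewrite /rdot dotBr ReB. Qed.
Lemma rdotZl (r : R) u w : rdot (r%:C%C *: u) w = r * rdot u w.
Proof. by rewrite /rdot dotZl Re_mulr. Qed.
Lemma rdotZr (r : R) u w : rdot w (r%:C%C *: u) = r * rdot w u.
Proof. by rewrite rdotC rdotZl rdotC. Qed.

Lemma rdot_ge0 u : 0 <= rdot u u.
Proof. by have := dnorm_ge0 hdot u; rewrite lecE => /andP[]. Qed.

Lemma rdot_eq0 u : rdot u u = 0 -> u = 0.
Proof.
move=> h; apply/eqP; rewrite -(dnorm_eq0 hdot) eq_complex -/(rdot u u) h eqxx.
by have := dnorm_ge0 hdot u; rewrite lecE => /andP[].
Qed.

Lemma hnorm_sqr u : hnorm u ^+ 2 = rdot u u.
Proof. by rewrite sqr_sqrtr // rdot_ge0. Qed.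

Lemma dot_self u : hdot u u = (hnorm u ^+ 2)%:C%C.
Proof.
rewrite hnorm_sqr; apply/eqP; rewrite eq_complex eqxx /=.
by have := dnorm_ge0 hdot u; rewrite lecE => /andP[].
Qed.

Lemma hnorm_ge0 u : 0 <= hnorm u.
Proof. exact: sqrtr_ge0. Qed.

Lemma hnorm0_eq0 u : hnorm u = 0 -> u = 0.
Proof. by move=> h; apply: rdot_eq0; rewrite -hnorm_sqr h expr0n. Qed.

Lemma hnorm0 : hnorm (0 : H) = 0.
Proof. by rewrite /hnorm /dot_norm dot0l sqrtr0. Qed.

Lemma hnormN u : hnorm (- u) = hnorm u.
Proof. by rewrite /hnorm /dot_norm dotNl dotNr opprK. Qed.

Lemma hnorm_subC u v : hnorm (u - v) = hnorm (v - u).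
Proof. by rewrite -hnormN opprB. Qed.

Lemma ler_hnorm u (r : R) : 0 <= r -> rdot u u <= r ^+ 2 -> hnorm u <= r.
Proof.
by move=> r0 h; rewrite -(ler_pXn2r (n := 2)) ?nnegrE ?hnorm_ge0 // hnorm_sqr.
Qed.

Lemma hnormZ (r : R) u : 0 <= r -> hnorm (r%:C%C *: u) = r * hnorm u.
Proof.
move=> r0; apply/eqP; rewrite -(eqrXn2 (n := 2)) ?mulr_ge0 ?hnorm_ge0 //.
by rewrite exprMn !hnorm_sqr rdotZl rdotZr mulrA.
Qed.

(** Cauchy-Schwarz: the squared norm of [u] minus its component along [v] is nonnegative. *)
Lemma rdot_sqr_le u v : rdot u v ^+ 2 <= rdot u u * rdot v v.
Proof.
have [v0|vn0] := eqVneq (rdot v v) 0.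
  by rewrite (rdot_eq0 v0) /rdot !dot0r /= expr0n mulr0.
have vp : 0 < rdot v v by rewrite lt_def vn0 rdot_ge0.
have := rdot_ge0 (u - (rdot u v / rdot v v)%:C%C *: v).
rewrite rdotBl !rdotBr !rdotZl !rdotZr (rdotC v u).
rewrite -(pmulr_rge0 _ vp) => h; rewrite -subr_ge0.
rewrite (_ : _ - _ = rdot v v * (rdot u u - rdot u v / rdot v v * rdot u v
  - (rdot u v / rdot v v * rdot u v
    - rdot u v / rdot v v * (rdot u v / rdot v v * rdot v v)))) //.
by field.
Qed.

Lemma rdot_le u v : `|rdot u v| <= hnorm u * hnorm v.
Proof.
rewrite -(ler_pXn2r (n := 2)) ?nnegrE ?mulr_ge0 ?hnorm_ge0 //.
by rewrite exprMn !hnorm_sqr real_normK ?num_real // rdot_sqr_le.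
Qed.

Lemma ler_hnormD u v : hnorm (u + v) <= hnorm u + hnorm v.
Proof.
apply: ler_hnorm; first by rewrite addr_ge0 ?hnorm_ge0.
rewrite rdotDl !rdotDr (rdotC v u) sqrrD !hnorm_sqr.
have := le_trans (ler_norm _) (rdot_le u v); lra.
Qed.

Lemma ler_hnorm_sub v u w : hnorm (u - w) <= hnorm (u - v) + hnorm (v - w).
Proof. by apply: le_trans (ler_hnormD _ _); rewrite addrA subrK. Qed.

Lemma hnorm_sqrB u v :
  hnorm (u - v) ^+ 2 = hnorm u ^+ 2 - 2 * rdot u v + hnorm v ^+ 2.
Proof. by rewrite !hnorm_sqr rdotBl !rdotBr (rdotC v u); ring. Qed.

Lemma rdot_dense (M : set H) u :
  (forall e : R, 0 < e -> exists2 v, M v & hnorm (u - v) < e) -> 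
  forall w, (forall v, M v -> rdot w v = 0) -> rdot w u = 0.
Proof.
move=> h w hw; apply/eqP; apply: contraT => wu.
have wp : 0 < hnorm w.
  rewrite lt_def hnorm_ge0 andbT; apply: contra wu => /eqP/hnorm0_eq0->.
  by rewrite /rdot dot0l.
have [|v Mv uv] := h (`|rdot w u| / hnorm w).
  by rewrite divr_gt0 // normr_gt0.
have := rdot_le w (u - v); rewrite rdotBr (hw v) // subr0.
by rewrite ltr_pdivlMr // in uv; rewrite mulrC leNgt uv.
Qed.

Lemma sub_hclosure M : M `<=` hclosure M.
Proof. by move=> u Mu e e0; exists u => //; rewrite subrr hnorm0. Qed.

Lemma hclosureK M : hclosure (hclosure M) `<=` hclosure M.
Proof.
move=> u Mu e e0; have e2 : 0 < e / 2 by rewrite divr_gt0.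
have [v Mv uv] := Mu _ e2; have [w Mw vw] := Mv _ e2; exists w => //.
by apply: le_lt_trans (ler_hnorm_sub v _ _) _; rewrite [e]splitr ltrD.
Qed.

(** On sets of pairs this is convertible with [linear_relation], so graphs are handled as subspaces
    of the product space. *)
Definition subspace M := M 0 /\ forall a u v, M u -> M v -> M (a *: u + v).

Lemma subspaceD M : subspace M -> forall u v, M u -> M v -> M (u + v).
Proof. by move=> [_ h] u v Mu Mv; rewrite -[u]scale1r; apply: h. Qed.

Lemma subspaceZ M : subspace M -> forall a u, M u -> M (a *: u).
Proof. by move=> [M0 h] a u Mu; rewrite -[_ *: _]addr0; apply: h. Qed.

Lemma subspaceB M : subspace M -> forall u v, M u -> M v -> M (u - v).
Proof.
move=> hM u v Mu Mv; rewrite -scaleN1r.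
by apply: (subspaceD hM Mu); exact: (subspaceZ hM).
Qed.

(** Testing with the multiple [hdot u v *: v] produces the squared modulus of [hdot u v]. *)
Lemma orth_rdot M u : subspace M -> (forall v, M v -> rdot u v = 0) ->
  forall v, M v -> hdot u v = 0.
Proof.
move=> hM h v Mv; apply: normCK_Re.
by rewrite -dotZr; apply: h; exact: subspaceZ.
Qed.

(** The crude constant [1 + |a|^2] avoids the modulus; only boundedness of the scaling matters. *)
Lemma hnormZ_le (a : R[i]) : exists2 c : R, 0 <= c &
  forall u, hnorm (a *: u) <= c * hnorm u.
Proof.
pose c := complex.Re (a * conjC a).
have c0 : 0 <= c.
  rewrite /c; case: (a) => x y /=; rewrite mulrN opprK.
  by rewrite addr_ge0 // -expr2 sqr_ge0.
exists (1 + c) => [|x]; first by rewrite addr_ge0.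
apply: ler_hnorm; first by rewrite mulr_ge0 ?hnorm_ge0 // addr_ge0.
rewrite /rdot dotZl dotZr mulrA dot_self [a * _]mulrC.
rewrite [X in complex.Re X]mulrC Re_mulr [_ * a]mulrC -/c mulrC exprMn.
by rewrite ler_wpM2r ?sqr_ge0 //; have := sqr_ge0 c; lra.
Qed.

Lemma hclosure_subspace M : subspace M -> subspace (hclosure M).
Proof.
move=> hM; split; first by apply: sub_hclosure; case: hM.
move=> a u v Mu Mv e e0; have e2 : 0 < e / 2 by rewrite divr_gt0.
have [c c0 hZ] := hnormZ_le a.
have c1 : 0 < 1 + c by rewrite ltr_wpDr.
have [|u' Mu' uu'] := Mu (e / 2 / (1 + c)); first by rewrite divr_gt0.
have [v' Mv' vv'] := Mv _ e2; exists (a *: u' + v'); first exact: hM.2.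
rewrite opprD addrACA -scalerBr [e]splitr.
apply: le_lt_trans (ler_hnormD _ _) _; apply: ltrD => //.
apply: le_lt_trans (hZ _) _.
apply: (@le_lt_trans _ _ ((1 + c) * hnorm (u - u'))).
  by rewrite ler_wpM2r ?hnorm_ge0 // lerDr.
by rewrite mulrC -ltr_pdivlMr.
Qed.

(** Moving along [v] to the best [t] lowers the squared norm by [rdot u v ^+ 2 / rdot v v], and less
    than [q] is available above the lower bound [d]. *)
Lemma rdot_sqr_near_min u v (d q : R) :
  (forall t : R, d <= rdot (u - t%:C%C *: v) (u - t%:C%C *: v)) ->
  rdot u u < d + q -> rdot u v ^+ 2 <= rdot v v * q.
Proof.
move=> dle ud; have [v0|vn0] := eqVneq (rdot v v) 0.
  by rewrite (rdot_eq0 v0) /rdot !dot0r /= expr0n mul0r.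
have vp : 0 < rdot v v by rewrite lt_def vn0 rdot_ge0.
have := dle (rdot u v / rdot v v); set t := _ / _.
have tE : t * rdot v v = rdot u v by rewrite divfK.
rewrite rdotBl !rdotBr !rdotZl !rdotZr (rdotC v) tE => le1.
rewrite -[in leLHS]tE expr2 -mulrA mulrCA ler_pM2l // mulrC tE.
by move: ud le1; rewrite [_ * t]mulrC; move: (t * _) => b; lra.
Qed.

(** A minimizing sequence is Cauchy by the parallelogram law. Near-minimality already makes
    [u - x n] almost orthogonal to [M], so orthogonality passes to the limit without proving that
    the infimum is attained. *)
Lemma projection M u : subspace M -> hclosure M `<=` M ->
  exists2 m, M m & forall v, M v -> hdot (u - m) v = 0.
Proof.
move=> hM cM.
pose E := [set rdot (u - v) (u - v) | v in M].
have E0 : E !=set0.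
  by exists (rdot (u - 0) (u - 0)); exists 0 => //; exact: hM.1.
have Elb : has_lbound E by exists 0 => _ [v _ <-]; exact: rdot_ge0.
pose d := inf E.
have dle v : M v -> d <= rdot (u - v) (u - v).
  by move=> Mv; apply: ge_inf => //; exists v.
have /choice[x hx] (n : nat) : exists v, M v /\
    rdot (u - v) (u - v) < d + n.+1%:R^-1.
  have [||_ [v Mv <-] lt] := @inf_adherent _ E (n.+1%:R^-1).
  - by rewrite invr_gt0 ltr0Sn.
  - by [].
  - by exists v.
(* Parallelogram law for [u - x m] and [u - x n], their midpoint being [u]
   minus a vector of [M]. *)
have par m n : hnorm (x m - x n) ^+ 2 <= 2 * (m.+1%:R^-1 + n.+1%:R^-1).
  have [Mm hm] := hx m; have [Mn hn] := hx n.
  have := dle ((2^-1 : R)%:C%C *: (x m + x n)).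
  move=> /(_ (subspaceZ hM _ (subspaceD hM Mm Mn))).
  rewrite hnorm_sqr; move: hm hn; set p := _^-1; set q := _^-1.
  rewrite !(rdotBl, rdotBr, rdotZl, rdotZr, rdotDl, rdotDr).
  rewrite !(rdotC _ u) (rdotC (x n) (x m)); lra.
have [|m hm] := @hdot_complete R H x.
  move=> e e0; have [|N hN] := @invn_small _ (e ^+ 2 / 4).
    by rewrite divr_gt0 ?exprn_gt0.
  exists N => m n Nm Nn; rewrite -/(hnorm _).
  rewrite -(ltr_pXn2r (n := 2)) ?nnegrE ?hnorm_ge0 ?ltW //.
  apply: le_lt_trans (par m n) _; move: (hN m Nm) (hN n Nn).
  by move: (m.+1%:R^-1) (n.+1%:R^-1) => p q; lra.
have Mm : M m.
  apply: cM => e e0; have [N hN] := hm e e0.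
  exists (x N); first by case: (hx N).
  by rewrite hnorm_subC; apply: hN.
exists m => //; apply: orth_rdot => // v Mv.
have orth n : rdot (u - x n) v ^+ 2 <= rdot v v * n.+1%:R^-1.
  have [Mn hn] := hx n; apply: rdot_sqr_near_min hn => t.
  have := dle _ (subspaceD hM Mn (subspaceZ hM t%:C%C Mv)).
  by rewrite opprD addrA.
(* The product splits over [u - x n] and [x n - m]. For large [n] both squares fall below [e], so
   the square of the sum is below [4 * e], which is its own value. *)
apply/eqP; apply: contraT => e0; pose e := rdot (u - m) v ^+ 2 / 4.
have ep : 0 < e by rewrite divr_gt0 // exprn_even_gt0.
have V0 : 0 <= rdot v v := rdot_ge0 v.
have V1 : 0 < 1 + rdot v v by rewrite ltr_wpDr.
have eV : 0 < e / (1 + rdot v v) by rewrite divr_gt0.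
have [N1 hN1] := invn_small eV.
have [|N2 hN2] := hm (Num.sqrt (e / (1 + rdot v v))).
  by rewrite sqrtr_gt0.
pose n := maxn N1 N2.
have lt3 := hN1 n (leq_maxl _ _); have le2 := orth n.
have lt1 : rdot (x n - m) (x n - m) < e / (1 + rdot v v).
  rewrite -hnorm_sqr -[ltRHS]sqr_sqrtr ?(ltW eV) //.
  by rewrite ltr_pXn2r ?nnegrE ?hnorm_ge0 ?sqrtr_ge0 //; exact/hN2/leq_maxr.
have le1 := rdot_sqr_le (x n - m) v.
have : rdot (u - m) v = rdot (u - x n) v + rdot (x n - m) v.
  by rewrite -rdotDl addrA subrK.
move: le1 le2 lt1 lt3; move: (rdot (u - x n) v) (rdot (x n - m) v) => a c.
move: (_^-1) (rdot (x n - m) _) => p q le1 le2 lt1 lt3 E1.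
have : rdot v v * (p + q) <= rdot v v * (2 * (e / (1 + rdot v v))).
  by rewrite ler_wpM2l //; lra.
have : rdot v v * (e / (1 + rdot v v)) < e.
  by rewrite mulrCA gtr_pMr // ltr_pdivrMr //; lra.
have : rdot (u - m) v ^+ 2 = 4 * e by rewrite /e; field.
rewrite E1; have := sqr_ge0 (a - c); nra.
Qed.

Lemma orth_hclosure M u : (forall v, M v -> hdot u v = 0) ->
  forall v, hclosure M v -> hdot u v = 0.
Proof.
move=> h v Mv; apply: normCK_Re; rewrite -dotZl.
apply: (rdot_dense Mv) => w Mw.
by rewrite /rdot dotZl (h w) // mulr0.
Qed.

(** The component of [u] orthogonal to the closure of [M] is itself an admissible [e]. *)
Lemma hclosure_bidual M u : subspace M ->
  (forall e, (forall v, M v -> hdot e v = 0) -> hdot u e = 0) -> hclosure M u.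
Proof.
move=> hM hu; have cM := hclosure_subspace hM.
have [m Mm orth] := projection u cM (@hclosureK M).
suff -> : u = m by [].
apply/subr0_eq/rdot_eq0; rewrite /rdot dotBl.
rewrite hu => [|v Mv]; last by apply: orth; exact: sub_hclosure.
by rewrite dot_eq0C ?subrr // orth.
Qed.

End Hilbert.

(** * Closed operators and G^* G *)

Section Pairs.
Context {R : realType} {H K : hilbertType R}.
Implicit Types (p q : H * K).

Lemma dot_pair p q : hdot p q = hdot p.1 q.1 + hdot p.2 q.2.
Proof. by []. Qed.

Lemma hnorm_pair_sqr p : hnorm p ^+ 2 = hnorm p.1 ^+ 2 + hnorm p.2 ^+ 2.
Proof. by rewrite !hnorm_sqr /rdot dot_pair ReD. Qed.

Lemma hnorm_fst_le p : hnorm p.1 <= hnorm p.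
Proof.
apply: ler_hnorm (hnorm_ge0 _) _.
by rewrite -hnorm_sqr hnorm_pair_sqr lerDl sqr_ge0.
Qed.

Lemma hnorm_snd_le p : hnorm p.2 <= hnorm p.
Proof.
apply: ler_hnorm (hnorm_ge0 _) _.
by rewrite -hnorm_sqr hnorm_pair_sqr lerDr sqr_ge0.
Qed.

Lemma hnorm_pair_le p : hnorm p <= hnorm p.1 + hnorm p.2.
Proof.
have [h1 h2] := (hnorm_ge0 p.1, hnorm_ge0 p.2).
apply: ler_hnorm; first by rewrite addr_ge0.
by rewrite -hnorm_sqr hnorm_pair_sqr sqrrD lerD2r lerDl mulrn_wge0 ?mulr_ge0.
Qed.

End Pairs.

Section Adjoint.
Context {R : realType} {H K : hilbertType R}.
Implicit Types (T : set (H * K)).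

Lemma adjoint_subspace T : subspace (adjoint T).
Proof.
split=> [q _|a p p' hp hp' q Tq] /=; first by rewrite !dot0r.
by rewrite !dotDr !dotZr hp // hp'.
Qed.

(** The adjoint is the orthogonal complement of the rotated graph [(q.2, - q.1)]. *)
Lemma adjoint_closed T : hclosure (adjoint T) `<=` adjoint T.
Proof.
move=> p hp q Tq; apply/subr0_eq.
have -> : hdot q.2 p.1 - hdot q.1 p.2 = hdot ((q.2, - q.1) : K * H) p.
  by rewrite dot_pair /= dotNl.
apply: orth_hclosure hp => p' hp'.
by rewrite dot_pair /= dotNl hp' // subrr.
Qed.

End Adjoint.

Section Gram.
Context {R : realType} {H K : hilbertType R}.
Implicit Types (G : set (H * K)).

(** The relation [G^* G]. *)
Definition gram G : set (H * H) :=
  [set p | exists2 y, G (p.1, y) & adjoint G (y, p.2)].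

Lemma gram_norm G x y z : G (x, y) -> adjoint G (y, z) ->
  hdot y y = hdot x z.
Proof. by move=> Gxy hyz; have := hyz _ Gxy. Qed.

Lemma gram_subspace G : subspace G -> subspace (gram G).
Proof.
move=> hG; split.
  by exists 0; [exact: hG.1 | exact: (adjoint_subspace G).1].
move=> a p q [y Gy hy] [y' Gy' hy']; exists (a *: y + y').
  exact: (hG.2 a _ _ Gy Gy').
exact: ((adjoint_subspace G).2 a _ _ hy hy').
Qed.

Lemma gram_nonneg G : nonnegative (gram G).
Proof.
move=> [x z] [y Gy hy] /=; rewrite dotC -(gram_norm Gy hy) conjC_ge0.
exact: dnorm_ge0.
Qed.

Lemma gram_symmetric G : symmetric_relation (gram G).
Proof.
move=> [x z] [y /= Gy hy] [x' z'] [y' /= Gy' hy'] /=.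
have /= <- := hy _ Gy'; have /= h := hy' _ Gy.
by rewrite dotC -h -dotC.
Qed.

(** Let [(x, y)] be the projection of [(f, 0)] onto the graph. The residual [(f - x, - y)] is
    orthogonal to the graph, which is exactly [G^* y = f - x]. *)
Lemma gram_surj G : subspace G -> hclosure G `<=` G ->
  forall f, exists x, gram G (x, f - x).
Proof.
move=> hG cG f; have [[x y] Gxy orth] := projection (f, 0) hG cG.
exists x, y => // -[a b] Gab /=.
have := dot_eq0C (orth _ Gab); rewrite dot_pair /= sub0r dotNr.
by move=> /subr0_eq.
Qed.

(** If [g] in the graph is orthogonal to the core, it is orthogonal to [(x, G x)] for the solution
    of [x + G^* G x = g.1]. That product equals [|g.1|^2], so [g.1 = 0], and [g.2 = 0] because [G]
    is single-valued. *)
Lemma gram_core G : linear_operator G -> hclosure G `<=` G ->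
  G `<=` hclosure [set p | G p /\ exists z, adjoint G (p.2, z)].
Proof.
move=> [hG mG] cG p Gp; apply: hclosure_bidual.
  split; first split; first exact: hG.1.
    by exists 0; exact: (adjoint_subspace G).1.
  move=> a q q' [Gq [z hz]] [Gq' [z' hz']]; split; first exact: hG.2.
  by exists (a *: z + z'); exact: ((adjoint_subspace G).2 a _ _ hz hz').
move=> e orth; have [g Gg he] := projection e hG cG.
suff g0 : g = 0 by have := dot_eq0C (he _ Gp); rewrite g0 subr0.
have orthg q z : G q -> adjoint G (q.2, z) -> hdot g q = 0.
  move=> Gq hz; rewrite -[g](subKr e) dotBl he // subr0.
  by apply: orth; split=> //; exists z.
have g10 : g.1 = 0.
  have [x [y Gxy /= hy]] := gram_surj hG cG g.1.
  apply: rdot_eq0; rewrite /rdot.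
  have := orthg (x, y) _ Gxy hy; rewrite dot_pair /=.
  have -> : hdot g.2 y = hdot g.1 (g.1 - x).
    exact: (hy g Gg).
  by rewrite -dotDr subrKC => ->.
have : Defs.mul G g.2 by rewrite /Defs.mul /= -g10 -surjective_pairing.
by rewrite mG => /= g20; case: (g) g10 g20 => ? ? /= -> ->.
Qed.

(** For [(p, q)] in the adjoint, solving [x + N x = p + q] leaves the pair [(p - x, -(p - x))] in
    the adjoint. Tested on the solution of [y + N y = p - x], it gives [|p - x|^2 = 0]. *)
Lemma symmetric_selfadjoint (N : set (H * H)) : subspace N ->
  symmetric_relation N -> (forall f, exists x, N (x, f - x)) -> selfadjoint N.
Proof.
move=> hN sN surj; apply/seteqP; split=> // -[p q] hpq.
have [x Nx] := surj (p + q).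
have he := subspaceB (adjoint_subspace N) hpq (sN _ Nx).
suff e0 : p - x = 0.
  have pE : p = x by apply/subr0_eq.
  by move: Nx; rewrite -pE addrAC subrr add0r.
have [y Ny] := surj (p - x).
apply: rdot_eq0; rewrite /rdot; have /= := he _ Ny.
have -> : q - (p + q - x) = - (p - x).
  by rewrite !opprB addrCA opprD [q + _]addrCA subrr addr0.
rewrite dotNr => /eqP; rewrite -subr_eq0 opprK -dotDl subrK => /eqP ->.
by [].
Qed.

Lemma gram_selfadjoint G : subspace G -> hclosure G `<=` G ->
  selfadjoint (gram G).
Proof.
move=> hG cG; apply: symmetric_selfadjoint.
- exact: gram_subspace.
- exact: gram_symmetric.
- exact: gram_surj.
Qed.

End Gram.

(** Over the domain of [G^* G] both squared norms equal the product of [x] with [G^* G x]. Core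
    approximations of [(a, b)] therefore have Cauchy values under [G'] as well, and [G'] is closed.
    Used in both directions between [couple] and a square root of [calA], this replaces uniqueness
    of the square root. *)
Lemma gram_form_le (R : realType) (H K K' : hilbertType R) (G : set (H * K))
    (G' : set (H * K')) :
  linear_operator G -> hclosure G `<=` G ->
  subspace G' -> hclosure G' `<=` G' -> gram G `<=` gram G' ->
  forall a b, G (a, b) -> exists2 b', G' (a, b') & hnorm b' = hnorm b.
Proof.
move=> lG cG hG' cG' le a b Gab; have hG : subspace G := lG.1.
have /choice[p hp] (n : nat) : 
    exists p : (H * K) * K', [/\ G p.1, G' (p.1.1, p.2),
    exists2 z, adjoint G (p.1.2, z) & adjoint G' (p.2, z)
    & hnorm ((a, b) - p.1) < n.+1%:R^-1].
  have [|[x y] [Gxy [z hz]] lt] := gram_core lG cG Gab (e := n.+1%:R^-1).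
    by rewrite invr_gt0 ltr0Sn.
  have [|y' Gy' hy'] := le (x, z); first by exists y.
  by exists ((x, y), y'); split=> //; exists z.
have normE m n : hnorm ((p m).2 - (p n).2) = hnorm ((p m).1.2 - (p n).1.2).
  have [Gm G'm [z hz hz'] _] := hp m; have [Gn G'n [w hw hw'] _] := hp n.
  apply/eqP; rewrite -(eqrXn2 (n := 2)) ?hnorm_ge0 // !hnorm_sqr /rdot.
  have h := subspaceB (adjoint_subspace G) hz hw.
  have h' := subspaceB (adjoint_subspace G') hz' hw'.
  have g := subspaceB hG Gm Gn; have g' := subspaceB hG' G'm G'n.
  by rewrite (gram_norm g' h') (gram_norm g h).
have bnorm n : hnorm (b - (p n).1.2) < n.+1%:R^-1.
  by have [_ _ _] := hp n; apply: le_lt_trans (hnorm_snd_le _).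
have anorm n : hnorm (a - (p n).1.1) < n.+1%:R^-1.
  by have [_ _ _] := hp n; apply: le_lt_trans (hnorm_fst_le _).
have [|b' hb'] := @hdot_complete R K' (fun n => (p n).2).
  move=> e e0; have [|N hN] := @invn_small _ (e / 2); first by rewrite divr_gt0.
  exists N => m n Nm Nn; rewrite -/(hnorm _) normE [e]splitr.
  apply: le_lt_trans (ler_hnorm_sub b _ _) _.
  rewrite hnorm_subC ltrD //.
    by apply: lt_trans (bnorm _) (hN _ _).
  by apply: lt_trans (bnorm _) (hN _ _).
have near (e : R) : 0 < e -> exists n,
    hnorm ((p n).2 - b') < e /\ n.+1%:R^-1 < e.
  move=> e0; have [N1 hN1] := hb' e e0; have [N2 hN2] := invn_small e0.
  exists (maxn N1 N2); split; first exact/hN1/leq_maxl.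
  exact/hN2/leq_maxr.
have norm_p n : hnorm (p n).2 = hnorm (p n).1.2.
  move: (hp n); case: (p n) => -[x y] y' /= [Gn G'n [z hz hz'] _].
  apply/eqP; rewrite -(eqrXn2 (n := 2)) ?hnorm_ge0 // !hnorm_sqr /rdot.
  by rewrite (gram_norm G'n hz') (gram_norm Gn hz).
exists b'.
  apply: cG' => e e0; have [|n [h1 h2]] := near (e / 2).
    by rewrite divr_gt0.
  exists ((p n).1.1, (p n).2); first by case: (hp n).
  apply: le_lt_trans (hnorm_pair_le _) _; rewrite [e]splitr ltrD //=.
    exact: lt_trans (anorm n) h2.
  by rewrite hnorm_subC.
apply/eqP; rewrite eq_le; apply/andP; split; apply/ler_addgt0Pl => e e0.
  have [|n [h1 h2]] := near (e / 2); first by rewrite divr_gt0.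
  have := ler_hnormD (b' - (p n).2) (p n).2; rewrite subrK norm_p hnorm_subC.
  have := ler_hnormD ((p n).1.2 - b) b; rewrite subrK hnorm_subC.
  have := lt_trans (bnorm n) h2; clear h2; lra.
have [|n [h1 h2]] := near (e / 2); first by rewrite divr_gt0.
have := ler_hnormD ((p n).2 - b') b'; rewrite subrK norm_p.
have := ler_hnormD (b - (p n).1.2) (p n).1.2; rewrite subrK.
have := lt_trans (bnorm n) h2; clear h2; lra.
Qed.

(** * Square root of 1 - P for a selfadjoint contraction P *)

Lemma small_real (R : realType) (r C : R) :
  (forall n : nat, r <= C * n.+1%:R^-1) -> r <= 0.
Proof.
move=> h; rewrite leNgt; apply/negP => r0.
have C0 : 0 < C by have := lt_le_trans r0 (h 0%N); rewrite invr1 mulr1.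
have [N /(_ _ (leqnn N))] := invn_small (divr_gt0 r0 C0).
by rewrite ltr_pdivlMr // mulrC ltNge h.
Qed.

Section BoundedSqrt.
Context {R : realType} {H : hilbertType R}.
Implicit Types (f g : H -> H) (u v x y : H).

Definition linop f := forall a u v, f (a *: u + v) = a *: f u + f v.
Definition symmetric_op f := forall u v, hdot (f u) v = hdot u (f v).
Definition contraction f := forall u, hnorm (f u) <= hnorm u.
Definition commute f g := forall u, f (g u) = g (f u).
Definition sa_contraction f := [/\ linop f, symmetric_op f & contraction f].

Lemma linopD f : linop f -> forall u v, f (u + v) = f u + f v.
Proof. by move=> h u v; have := h 1 u v; rewrite !scale1r. Qed.

Lemma linop0 f : linop f -> f 0 = 0.
Proof.
by move=> h; have := h (-1) 0 0; rewrite scaler0 addr0 scaleN1r addNr.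
Qed.

Lemma linopZ f : linop f -> forall a u, f (a *: u) = a *: f u.
Proof. by move=> h a u; have := h a u 0; rewrite addr0 linop0 // addr0. Qed.

Lemma linopB f : linop f -> forall u v, f (u - v) = f u - f v.
Proof. by move=> h u v; rewrite linopD // -scaleN1r linopZ // scaleN1r. Qed.

Lemma small_vector x (C : R) :
  (forall n : nat, hnorm x <= C * n.+1%:R^-1) -> x = 0.
Proof.
move=> /small_real h; apply: hnorm0_eq0; apply/eqP.
by rewrite eq_le h hnorm_ge0.
Qed.

Section Iteration.
Variable P : H -> H.
Hypothesis hP : sa_contraction P.

Fixpoint sqrt_iter n u : H :=
  if n is m.+1 then (2^-1 : R)%:C%C *: (P u + sqrt_iter m (sqrt_iter m u))
  else 0.

(* The iteration for [P = 1], whose increments dominate those of [sqrt_iter]. *)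
Fixpoint sqrt_rate n : R :=
  if n is m.+1 then (1 + sqrt_rate m ^+ 2) / 2 else 0.

Local Notation Y := sqrt_iter.
Local Notation a := sqrt_rate.

Lemma sqrt_rate_ge0 n : 0 <= a n.
Proof. by elim: n => //= n h; rewrite divr_ge0 // addr_ge0 ?sqr_ge0. Qed.

(** The gap [b = 1 - a n] evolves by [b - b^2 / 2], hence decays like [2 / n]. *)
Lemma sqrt_rate_near n : 1 - a n <= 2 / (n.+2%:R) /\ a n <= 1.
Proof.
elim: n => [|n [h1 h2]] /=.
  by split; [rewrite subr0 divff | exact: ler01].
have h0 := sqrt_rate_ge0 n; split; last nra.
move: h1; rewrite !ler_pdivlMr ?ltr0Sn // -[n.+3%:R]natr1.
have : (2 : R) <= n.+2%:R by rewrite ler_nat.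
move: (n.+2%:R : R) => c c2 h.
pose b := 1 - a n; have -> : a n = 1 - b by rewrite /b; ring.
have bc : b * c <= 2 by [].
have b0 : 0 <= b by rewrite subr_ge0.
have : b * (b * c) <= b * 2 by rewrite ler_wpM2l.
nra.
Qed.

Lemma sqrt_iter_linop n : linop (Y n).
Proof.
have [lP _ _] := hP.
elim: n => [|n h] b u v /=; first by rewrite scaler0 addr0.
rewrite lP !h addrACA [LHS]scalerDr; congr (_ + _).
by rewrite -scalerDr !scalerA mulrC.
Qed.

Lemma sqrt_iter_sym n : symmetric_op (Y n).
Proof.
have [_ sP _] := hP; elim: n => [|n h] u v /=; first by rewrite dot0l dot0r.
by rewrite dotZl dotZr_real dotDl dotDr sP !h.
Qed.

Lemma sqrt_iter_bound n u : hnorm (Y n u) <= a n * hnorm u.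
Proof.
have [_ _ cP] := hP; elim: n u => [|n h] u /=; first by rewrite hnorm0 mul0r.
rewrite hnormZ ?invr_ge0 // [_ / 2]mulrC -mulrA ler_pM2l ?invr_gt0 //.
apply: le_trans (ler_hnormD _ _) _; rewrite mulrDl mul1r lerD //.
rewrite expr2 -mulrA; apply: le_trans (h _) _.
by rewrite ler_wpM2l ?sqrt_rate_ge0.
Qed.

Lemma sqrt_iter_contraction n : contraction (Y n).
Proof.
move=> u; apply: le_trans (sqrt_iter_bound n u) _.
by rewrite ler_piMl ?hnorm_ge0 //; case: (sqrt_rate_near n).
Qed.

Lemma sqrt_iter_commute Z n : linop Z -> commute Z P -> commute Z (Y n).
Proof.
move=> lZ cZ; elim: n => [|n h] u /=; first exact: linop0.
by rewrite linopZ // linopD // cZ !h.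
Qed.

Lemma sqrt_iter_commute_iter m n : commute (Y m) (Y n).
Proof.
apply: sqrt_iter_commute; first exact: sqrt_iter_linop.
by move=> u; rewrite [RHS]sqrt_iter_commute //; case: hP.
Qed.

(** The iterates commute, so the next increment is half of [Y n.+1 + Y n] applied to the present
    one; [a] satisfies the same identity. *)
Lemma sqrt_iter_step n u :
  hnorm (Y n.+1 u - Y n u) <= (a n.+1 - a n) * hnorm u.
Proof.
elim: n u => [|n h] u.
  by rewrite !subr0; exact: sqrt_iter_bound.
set Y1 := Y n.+1; set Y0 := Y n.
have -> : Y n.+2 u - Y1 u = (2^-1 : R)%:C%C *:
    (Y1 (Y1 u - Y0 u) + Y0 (Y1 u - Y0 u)).
  rewrite /Y1 [Y n.+2]/= [in X in _ - X]/= -/Y1 -scalerBr; congr (_ *: _).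
  have lY1 : linop Y1 := sqrt_iter_linop _.
  have lY0 : linop Y0 := sqrt_iter_linop _.
  rewrite (linopB lY1) (linopB lY0) [Y1 (Y0 u)]sqrt_iter_commute_iter.
  rewrite opprD addrACA subrr add0r.
  by rewrite addrA subrK.
rewrite hnormZ ?invr_ge0 //.
apply: (@le_trans _ _ (2^-1 * ((a n.+1 + a n) * ((a n.+1 - a n) * hnorm u)))).
  rewrite ler_pM2l ?invr_gt0 //; apply: le_trans (ler_hnormD _ _) _.
  rewrite [leRHS]mulrDl; apply: lerD; apply: le_trans (sqrt_iter_bound _ _) _;
    by rewrite ler_wpM2l ?sqrt_rate_ge0.
rewrite [a n.+2]/= mulrA mulrA ler_wpM2r ?hnorm_ge0 //.
by rewrite le_eqVlt; apply/orP; left; apply/eqP; rewrite [a n.+1]/=; field.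
Qed.

Lemma sqrt_iter_dist n k u :
  hnorm (Y (k + n) u - Y n u) <= (a (k + n) - a n) * hnorm u.
Proof.
elim: k => [|k h]; first by rewrite !subrr hnorm0 mul0r.
apply: le_trans (ler_hnorm_sub (Y (k + n) u) _ _) _.
have := sqrt_iter_step (k + n) u; rewrite addSn.
by move: h; rewrite !mulrBl; lra.
Qed.

(** The increments after [n] add up to at most [1 - a n]. The explicit rate lets identities pass to
    the limit through [small_real] and [small_vector]. *)
Lemma sqrt_iter_cvg u : exists l,
  forall n, hnorm (l - Y n u) <= 2 * hnorm u * n.+1%:R^-1.
Proof.
have dist m n : (n <= m)%N ->
    hnorm (Y m u - Y n u) <= 2 * hnorm u * n.+1%:R^-1.
  move=> nm; rewrite -(subnK nm); apply: le_trans (sqrt_iter_dist _ _ _) _.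
  rewrite mulrAC ler_wpM2r ?hnorm_ge0 //.
  have [_ h1] := sqrt_rate_near (m - n + n); have [h2 _] := sqrt_rate_near n.
  apply: (@le_trans _ _ (1 - a n)); first by rewrite lerD2r.
  apply: le_trans h2 _; rewrite ler_pM2l // lef_pV2 ?posrE ?ltr0Sn //.
  by rewrite ler_nat.
have [|l hl] := @hdot_complete R H (fun n => Y n u).
  move=> e e0; pose c := 4 * hnorm u + 1.
  have c0 : 0 < c by rewrite ltr_wpDl // mulr_ge0 ?hnorm_ge0.
  have [N hN] := invn_small (divr_gt0 e0 c0).
  exists N => m n Nm Nn; rewrite -/(hnorm _).
  apply: le_lt_trans (ler_hnorm_sub (Y N u) _ _) _.
  have := dist _ _ Nm; have := dist _ _ Nn; rewrite (hnorm_subC (Y n u)).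
  have := hN N (leqnn N); rewrite ltr_pdivlMr // /c.
  have : 0 < N.+1%:R^-1 :> R by rewrite invr_gt0 ltr0Sn.
  move: (_^-1) => q; lra.
exists l => n; apply/ler_addgt0Pl => e e0; have [N hN] := hl e e0.
apply: le_trans (ler_hnorm_sub (Y (maxn N n) u) _ _) _.
apply: lerD; last exact/dist/leq_maxr.
by rewrite hnorm_subC ltW //; exact/hN/leq_maxl.
Qed.

End Iteration.
End BoundedSqrt.

Section SqrtOfOneMinus.
Context {R : realType} {H : hilbertType R}.
Implicit Types (f g P L : H -> H) (u v x y : H).

(* The limit [L] of the iteration [Y <- (P + Y^2) / 2] solves
   [(1 - L)^2 = 1 - P]. *)
Lemma sqrt_one_minus P : sa_contraction P -> exists L,
  [/\ sa_contraction L,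
      forall u, u - L u - L (u - L u) = u - P u
    & forall Z, linop Z -> contraction Z -> commute Z P -> commute Z L].
Proof.
move=> hP; have [L hL] := choice (sqrt_iter_cvg hP).
pose Y := sqrt_iter P.
have lY n : linop (Y n) := sqrt_iter_linop hP n.
have cY n : contraction (Y n) := sqrt_iter_contraction hP n.
have lL : linop L.
  move=> a u v; apply/subr0_eq; have [c c0 hc] := @hnormZ_le R H a.
  pose C := 2 * (hnorm (a *: u + v) + c * hnorm u + hnorm v).
  apply: (@small_vector _ _ _ C).
  move=> n; have h1 := hL (a *: u + v) n; have h2 := hL u n; have h3 := hL v n.
  have -> : L (a *: u + v) - (a *: L u + L v) =
     (L (a *: u + v) - Y n (a *: u + v)) + (a *: (Y n u - L u) + (Y n v - L v)).
    by rewrite lY scalerBr [X in _ = _ + X]addrACA -opprD addrA subrK.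
  apply: le_trans (ler_hnormD _ _) _.
  have := ler_hnormD (a *: (Y n u - L u)) (Y n v - L v).
  have := hc (Y n u - L u); have := ler_wpM2l c0 h2.
  rewrite (hnorm_subC (Y n u)) (hnorm_subC (Y n v)) /C.
  move: h1 h3; move: (_^-1) => q; lra.
have cL : contraction L.
  move=> u; rewrite -subr_le0; apply: (@small_real _ _ (2 * hnorm u)) => n.
  have := hL u n; have := cY n u; have := ler_hnormD (L u - Y n u) (Y n u).
  rewrite subrK; move: (_^-1) => q; lra.
have sL : symmetric_op L.
  have rs u v : rdot (L u) v = rdot u (L v).
    apply/subr0_eq; apply/eqP; rewrite -normr_le0.
    apply: (@small_real _ _ (4 * (hnorm u * hnorm v))) => n.
    have -> : rdot (L u) v - rdot u (L v) =
        rdot (L u - Y n u) v - rdot u (L v - Y n v).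
      rewrite rdotBl rdotBr (_ : rdot (Y n u) v = rdot u (Y n v)).
        by ring.
      by rewrite /rdot sqrt_iter_sym.
    have h1 := rdot_le (L u - Y n u) v; have h2 := rdot_le u (L v - Y n v).
    have h3 := ler_wpM2r (hnorm_ge0 v) (hL u n).
    have h4 := ler_wpM2l (hnorm_ge0 u) (hL v n).
    apply: le_trans (ler_normB _ _) _.
    move: h3 h4 h1 h2; move: (_^-1) => q; lra.
  (* Real symmetry [rs], applied to a complex multiple of [u], yields complex symmetry. *)
  move=> u v; apply/subr0_eq; apply: normCK_Re.
  set c := _ - _; rewrite mulrBr ReB -!dotZl -(linopZ lL).
  by apply/eqP; rewrite subr_eq0; apply/eqP/rs.
exists L; split=> //.
  move=> u; rewrite (linopB lL).
  suff : (2 : R)%:C%C *: L u = P u + L (L u).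
    have -> : (2 : R)%:C%C = 1 + 1 by rewrite -rmorphD.
    rewrite scalerDl scale1r => E.
    rewrite opprB [L (L u) - _]addrC addrA -[u - _ - _]addrA -opprD E.
    by rewrite opprD addrA subrK.
  apply/subr0_eq.
  apply: (@small_vector _ _ _ (6 * hnorm u + 2 * hnorm (L u))) => n.
  have h1 := hL u n.+1; have h2 := hL u n; have h3 := hL (L u) n.
  have -> : (2 : R)%:C%C *: L u - (P u + L (L u)) =
      (2 : R)%:C%C *: (L u - Y n.+1 u) +
      (Y n (Y n u - L u) + (Y n (L u) - L (L u))).
    rewrite scalerBr [in Y n.+1]/= scalerA -rmorphM /= divff // scale1r.
    by rewrite (linopB (lY n)) [X in _ = _ + X]subrKA !opprD !addrA subrK.
  apply: le_trans (ler_hnormD _ _) _; rewrite hnormZ //.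
  have := ler_hnormD (Y n (Y n u - L u)) (Y n (L u) - L (L u)).
  have := cY n (Y n u - L u); rewrite (hnorm_subC (Y n u)).
  rewrite (hnorm_subC (Y n (L u))).
  have : 2 * hnorm u * n.+2%:R^-1 <= 2 * hnorm u * n.+1%:R^-1.
    rewrite ler_wpM2l ?mulr_ge0 ?hnorm_ge0 //.
    by rewrite lef_pV2 ?posrE ?ltr0Sn // ler_nat.
  move: h1 h2 h3; move: (n.+1%:R^-1) (n.+2%:R^-1) => p q; lra.
move=> Z lZ cZ ZP u; apply/subr0_eq.
apply: (@small_vector _ _ _ (2 * hnorm u + 2 * hnorm (Z u))) => n.
have -> : Z (L u) - L (Z u) = Z (L u - Y n u) + (Y n (Z u) - L (Z u)).
  by rewrite (linopB lZ) [Z (Y n u)]sqrt_iter_commute // addrA subrK.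
apply: le_trans (ler_hnormD _ _) _.
have := cZ (L u - Y n u); rewrite (hnorm_subC (Y n _)).
move: (hL u n) (hL (Z u) n); move: (_^-1) => q; lra.
Qed.

Lemma one_minus_ge0 L : sa_contraction L -> forall u, 0 <= hdot (u - L u) u.
Proof.
move=> [_ sL cL] u; rewrite dotBl lecE ReB.
have -> : complex.Im (hdot u u - hdot (L u) u) = 0.
  rewrite dot_self.
  have : hdot (L u) u = conjC (hdot (L u) u) by rewrite -dotC sL.
  by case: (hdot (L u) u) => x y /= [] h; rewrite sub0r; lra.
rewrite eqxx /= subr_ge0 -/(rdot _ _) -/(rdot _ _) -hnorm_sqr expr2.
apply: le_trans (ler_norm _) _; apply: le_trans (rdot_le _ _) _.
by rewrite ler_wpM2r ?hnorm_ge0.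
Qed.

End SqrtOfOneMinus.

(** * Square root of a nonnegative selfadjoint operator *)

Lemma subrBAC (V : zmodType) (x a b c : V) :
  x - a - (b - c) = x - b - (a - c).
Proof.
by rewrite !opprB [LHS]addrACA [RHS]addrACA [- a - b]addrC.
Qed.

Section SqrtExists.
Context {R : realType} {H : hilbertType R}.
Implicit Types (T B : set (H * H)) (u v x y z : H).

Section Resolvent.
Variable T : set (H * H).
Hypothesis linT : linear_operator T.
Hypothesis symT : symmetric_relation T.
Hypothesis nnegT : nonnegative T.
Hypothesis surjT : forall f, exists x, T (x, f - x).

Lemma resolvent_uniq f x y : T (x, f - x) -> T (y, f - y) -> x = y.
Proof.
move=> Tx Ty; have := subspaceB linT.1 Tx Ty => Txy.
have /= := nnegT Txy; rewrite opprB addrC addrA subrK -opprB dotNl oppr_ge0.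
rewrite dot_self lecR => h; apply/subr0_eq/rdot_eq0/eqP.
by rewrite -hnorm_sqr eq_le h sqr_ge0.
Qed.

(** With [Q = (1 + T)^-1], the expansion of [|u|^2] along [u = Q u + (u - Q u)] has a nonnegative
    cross term, so [Q] and [1 - Q] are both contractions. Single-valuedness of [T] is injectivity of
    [Q]. *)
Lemma resolvent : exists Q : H -> H,
  [/\ sa_contraction Q, sa_contraction (fun x => x - Q x),
      forall x, Q x = 0 -> x = 0 & T = [set (Q x, x - Q x) | x in setT]].
Proof.
have [Q hQ] := choice surjT; exists Q.
have lQ : linop Q.
  move=> a u v; apply: resolvent_uniq (hQ _) _.
  by rewrite opprD addrACA -scalerBr; exact: linT.1.2 (hQ u) (hQ v).
have sQ : symmetric_op Q.
  move=> u v; have /= := symT (hQ v) (hQ u).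
  by rewrite dotBl dotBr => /addIr ->.
have norm2 u : hnorm u ^+ 2 =
    hnorm (Q u) ^+ 2 + 2 * rdot (u - Q u) (Q u) + hnorm (u - Q u) ^+ 2.
  rewrite !hnorm_sqr !(rdotBl, rdotBr) (rdotC u (Q u)); ring.
have pos u : 0 <= rdot (u - Q u) (Q u).
  by have := nnegT (hQ u); rewrite lecE => /andP[].
have TQ : T = [set (Q x, x - Q x) | x in setT].
  apply/seteqP; split=> [[p q] Tpq|_ [x _ <-]]; last exact: hQ.
  have E : p = Q (p + q).
    by apply: resolvent_uniq (hQ (p + q)); rewrite addrAC subrr add0r.
  by exists (p + q) => //; rewrite -E addrAC subrr add0r.
split=> //.
- split=> // u; apply: ler_hnorm (hnorm_ge0 _) _; rewrite -hnorm_sqr (norm2 u).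
  by rewrite -addrA lerDl addr_ge0 ?sqr_ge0 // mulr_ge0.
- split=> [a u v|u v|u].
  + by rewrite lQ opprD addrACA scalerBr.
  + by rewrite dotBl dotBr sQ.
  + apply: ler_hnorm (hnorm_ge0 _) _; rewrite -hnorm_sqr (norm2 u).
    by rewrite lerDr addr_ge0 ?sqr_ge0 // mulr_ge0.
- move=> x Qx0; have := hQ x; rewrite Qx0 subr0 => Tx.
  by have : Defs.mul T x by []; rewrite linT.2.
Qed.

(* With [Q = (1 + T)^-1] and commuting nonnegative [C = Q^(1/2)],
   [D = (1 - Q)^(1/2)], the square root of [T] is the graph [{(C x, D x)}]. *)
Lemma sqrt_exists : exists B, is_sqrt_in setT T B.
Proof.
have [Q [hQ hQ1 Q0 ->]] := resolvent.
have [L1 [hL1 sq1 com1]] := sqrt_one_minus hQ1.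
have [L2 [hL2 sq2 com2]] := sqrt_one_minus hQ.
(* The further root [E = C^(1/2)] serves nonnegativity only: the product of [D x] and [C x] is that
   of [D (E x)] and [E x]. *)
have [L3 [hL3 sq3 com3]] := sqrt_one_minus hL1.
have [[[lL1 sL1 cL1] [lL2 sL2 cL2]] [lL3 sL3 cL3]] := (hL1, hL2, hL3).
have [lQ sQ cQ] := hQ.
pose C x := x - L1 x; pose D x := x - L2 x; pose E x := x - L3 x.
have c2Q : commute L2 Q by move=> u; rewrite -[LHS]com2.
have c21 : commute L2 L1.
  by apply: com1 => // u; rewrite (linopB lL2) c2Q.
have c23 : commute L2 L3 by apply: com3.
have CC x : C (C x) = Q x by rewrite /C sq1 subKr.
have DD x : D (D x) = x - Q x by rewrite /D sq2.
have EE x : E (E x) = C x by rewrite /E sq3.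
have CD x : C (D x) = D (C x).
  rewrite /C /D (linopB lL1) (linopB lL2) -c21; exact: subrBAC.
have DE x : D (E x) = E (D x).
  rewrite /E /D (linopB lL3) (linopB lL2) -c23; exact: subrBAC.
have lC : linop C by move=> a u v; rewrite /C lL1 opprD addrACA scalerBr.
have lD : linop D by move=> a u v; rewrite /D lL2 opprD addrACA scalerBr.
have sC : symmetric_op C by move=> u v; rewrite dotBl dotBr sL1.
have sD : symmetric_op D by move=> u v; rewrite dotBl dotBr sL2.
have sE : symmetric_op E by move=> u v; rewrite dotBl dotBr sL3.
(* Since [C^2 + D^2 = 1], the parameter of a pair [(y, z)] of the graph can only be [C y + D z]. *)
have key y z : D y = C z -> C (C y + D z) = y /\ D (C y + D z) = z.
  move=> h; rewrite (linopD lC) (linopD lD) CC CD -h DD addrC subrK.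
  by split=> //; rewrite -CD h CC DD addrC subrK.
exists [set (C x, D x) | x in setT]; split.
- split; first split.
  + by exists 0; rewrite ?(linop0 lC) ?(linop0 lD).
  + move=> a _ _ [x _ <-] [y _ <-]; exists (a *: x + y) => //.
    by rewrite lC lD.
  + apply/seteqP; split=> [w [x _ [Cx0 <-]]|_ ->] /=.
      by rewrite (Q0 x) ?(linop0 lD) // -CC Cx0 (linop0 lC).
    by exists 0; rewrite ?(linop0 lC) ?(linop0 lD).
- move=> _ [x _ <-] /=; rewrite -EE -sE -DE; exact: one_minus_ge0.
- apply/seteqP; split=> [_ [x _ <-]|[z y] [hzy _]] /=.
    by split=> // _ [y _ <-] /=; rewrite -sC CD sD.
  have [h1 h2] : C (C z + D y) = z /\ D (C z + D y) = y.
    apply: key; apply/subr0_eq/rdot_eq0; rewrite /rdot dotBr.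
    (* The parameter [D z - C y] of the test pair is the vector that has to vanish. *)
    have /= := hzy (C (D z - C y), D (D z - C y)) (ex_intro2 _ _ _ I erefl).
    by rewrite sD sC => ->; rewrite subrr.
  by exists (C z + D y); rewrite ?h1 ?h2.
- apply/seteqP; split=> [[p q] /=|_ [z _ <-]] /=.
    move=> [w [x _ [<- <-]] [y _ [Cy <-]]].
    have [h1 h2] := key x y (esym Cy); exists (C x + D y) => //.
    by rewrite -DD -CC h1 h2.
  exists (D (C z)).
    by exists (C z); rewrite ?CC.
  by exists (D z); rewrite ?DD ?CD.
Qed.

End Resolvent.
End SqrtExists.

(** * Square root of the inverse relation *)

Section Values.
Context {R : realType} {H K : hilbertType R}.
Implicit Types (T : set (H * K)).

Lemma operator_uniq T u w w' : linear_operator T -> T (u, w) -> T (u, w') ->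
  w = w'.
Proof.
move=> [hT mT] Tw Tw'; have := subspaceB hT Tw Tw' => Tww.
have : Defs.mul T (w - w') by rewrite /Defs.mul /= -(subrr u).
by rewrite mT => /subr0_eq.
Qed.

Lemma valueE T u w : linear_operator T -> T (u, w) -> value T u = w.
Proof.
move=> hT Tw; apply: (operator_uniq hT _ Tw).
by rewrite /value; case: xgetP => [y _ Ty|/(_ w)]; [exact: Ty | case].
Qed.

End Values.

Section SqrtIn.
Context {R : realType} {H : hilbertType R}.
Implicit Types (T B C : set (H * H)) (M : set H) (u v w x y z e f : H).

Lemma selfadjoint_inT B : selfadjoint_in setT B -> adjoint B = B.
Proof. by rewrite /selfadjoint_in setXTT setIT => <-. Qed.

Lemma sqrt_inP M T B : is_sqrt_in M T B -> is_sqrt_in M T (sqrt_in M T).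
Proof. by move=> h; rewrite /sqrt_in; apply: (@xgetPex _ set0); exists B. Qed.

(** The default [set0] has empty domain, so a single vector in the domain certifies that a square
    root exists. *)
Lemma sqrt_op_inhabited T u : dom (sqrt_op T) u ->
  is_sqrt_in setT T (sqrt_op T).
Proof.
have [[B hB] _|N] := pselect (exists B, is_sqrt_in setT T B).
  exact: sqrt_inP hB.
have -> : sqrt_op T = set0.
  by apply: xgetPN => B hB; apply: N; exists B.
by move=> [? []].
Qed.

Lemma selfadjoint_inP M C : selfadjoint_in M C -> forall p,
  C p <-> [/\ adjoint C p, M p.1 & M p.2].
Proof.
move=> saC p.
have -> : C p = (adjoint C `&` M `*` M) p by rewrite -saC.
by split=> [[? []]|[? ? ?]].
Qed.

Lemma selfadjoint_in_closed M C : hclosure M `<=` M ->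
  selfadjoint_in M C -> hclosure C `<=` C.
Proof.
move=> cM saC p hp; have CP := selfadjoint_inP saC; apply/CP; split.
- apply: adjoint_closed => e e0; have [q Cq lt] := hp e e0; exists q => //.
  by have [] := (CP q).1 Cq.
- apply: cM => e e0; have [q /CP[_ M1 M2] lt] := hp e e0.
  by exists q.1 => //; apply: le_lt_trans (hnorm_fst_le (p - q)) lt.
- apply: cM => e e0; have [q /CP[_ M1 M2] lt] := hp e e0.
  by exists q.2 => //; apply: le_lt_trans (hnorm_snd_le (p - q)) lt.
Qed.

Section Inverse.
Variables T B : set (H * H).
Hypothesis saT : selfadjoint T.
Hypothesis linT : subspace T.
Hypothesis sqrtB : is_sqrt_in setT T B.

Let M := hclosure (dom (inverse T)).

Lemma sqrtW x y z : B (x, y) -> B (y, z) -> T (x, z).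
Proof. by move: sqrtB => [_ _ _ <-] Bxy Byz; exists y. Qed.

Lemma sqrtV x z : T (x, z) -> exists2 y, B (x, y) & B (y, z).
Proof. by move: sqrtB => [_ _ _ <-]. Qed.

Lemma sqrt_sym x y x' y' : B (x, y) -> B (x', y') -> hdot y x' = hdot x y'.
Proof.
move: sqrtB => [_ _ /selfadjoint_inT saB _] Bxy.
by rewrite -{1}saB => /(_ _ Bxy).
Qed.

Lemma sqrt_rdot x y z : B (x, y) -> B (y, z) -> rdot y y = rdot x z.
Proof. by move=> Bxy Byz; rewrite /rdot (sqrt_sym Bxy Byz). Qed.

Lemma sqrt_ker e : T (e, 0) -> B (e, 0).
Proof.
move=> /sqrtV[y Bey By0]; suff -> : 0 = y by [].
by apply/esym/rdot_eq0; rewrite (sqrt_rdot Bey By0) /rdot dot0r.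
Qed.

Lemma dom_inverse_subspace : subspace (dom (inverse T)).
Proof.
split; first by exists (0, 0) => //; exact: linT.1.
move=> a _ _ [[f x] /= Tx <-] [[g y] /= Ty <-].
exists (a *: f + g, a *: x + y) => //.
exact: (linT.2 a _ _ Tx Ty).
Qed.

Lemma range_subspace : subspace M.
Proof. exact/hclosure_subspace/dom_inverse_subspace. Qed.

Lemma range_closed : hclosure M `<=` M.
Proof. exact: hclosureK. Qed.

Lemma kerP e : (forall f, M f -> hdot e f = 0) <-> T (e, 0).
Proof.
split=> [h|].
  rewrite saT => -[x f] /= Tf; rewrite dot0r; apply/dot_eq0C/h.
  by apply: sub_hclosure; exists (f, x).
move=> Te; apply: orth_hclosure => f [[g x] /= Tg <-].
move: Te; rewrite saT => /(_ _ Tg) /= h; apply: dot_eq0C.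
by rewrite h dot0r.
Qed.

Lemma rangeP x : (forall e, T (e, 0) -> hdot x e = 0) <-> M x.
Proof.
split=> [h|Mx e /kerP h]; last exact/dot_eq0C/h.
apply: hclosure_bidual; first exact: dom_inverse_subspace.
by move=> e he; apply/h/kerP; exact: orth_hclosure.
Qed.

Lemma range_sqrt x y : B (x, y) -> M y.
Proof.
move=> Bxy; apply/rangeP => e /sqrt_ker Be.
by rewrite (sqrt_sym Bxy Be) dot0r.
Qed.

Lemma range_split x : exists2 x', M x' & T (x - x', 0).
Proof.
have [x' Mx' h] := projection x range_subspace range_closed.
by exists x' => //; apply/kerP.
Qed.

Lemma op_part_inverseP f x :
  op_part (inverse T) (f, x) <-> T (x, f) /\ M x.
Proof.
split=> -[Tx h]; split=> //; first by apply/rangeP => e; exact: h.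
by move=> e; move/rangeP: h => h; exact: h.
Qed.

(** The witness is [B^-1] with values restricted to [M]. As [M] is the orthogonal complement of the
    common kernel of [T] and [B], this makes it single-valued. *)
Lemma inverse_sqrt_exists : exists C, is_sqrt_in M (op_part (inverse T)) C.
Proof.
have [[linB mulB] nnB _ _] := sqrtB.
have MB := range_sqrt; have Mlin := range_subspace.
exists [set p | B (p.2, p.1) /\ M p.2]; split.
- split; first split.
  + by split; [exact: linB.1 | exact: Mlin.1].
  + move=> a p q [Bp Mp] [Bq Mq]; split; last exact: Mlin.2.
    exact: (linB.2 a _ _ Bp Bq).
  + apply/seteqP; split=> [h [/= Bh Mh]|_ ->]; last first.
      by split; [exact: linB.1 | exact: Mlin.1].
    apply: rdot_eq0; rewrite /rdot; have /rangeP -> // := Mh.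
    exact: sqrtW Bh linB.1.
- by move=> p [Bp _]; have := nnB _ Bp; rewrite [hdot p.2 _]dotC conjC_ge0.
- apply/seteqP; split=> [[f h] [/= Bh Mh]|[f h] [hfh [/= Mf Mh]]].
    split; last by split=> //=; exact: MB Bh.
    by move=> [g k] [/= Bk Mk]; rewrite /= (sqrt_sym Bk Bh).
  split=> //=; have [_ _ /selfadjoint_inT <- _] := sqrtB => -[a b] /= Bab.
  (* Only first components in [M] may be tested; replacing [a] by [a'] changes neither its value [b]
     nor its product with [f]. *)
  have [a' Ma' Ta] := range_split a.
  have /= -> : hdot b h = hdot a' f.
    have /= <- // := hfh (b, a').
    split=> //=; have : B (a - (a - a'), b - 0).
      exact (subspaceB linB Bab (sqrt_ker Ta)).
    by rewrite subr0 subKr.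
  rewrite -[in RHS](subrK a' a) dotDl.
  by have /kerP -> // := Ta; rewrite add0r.
- apply/seteqP; split=> [[f x] [w [/= Bw Mw] [/= Bx Mx]]|[f x]].
    by apply/op_part_inverseP; split=> //; exact: sqrtW Bx Bw.
  move=> /op_part_inverseP [/sqrtV[w Bxw Bwf] Mx]; exists w; split=> //=.
  exact: MB Bxw.
Qed.

Section AnySqrt.
Variable C : set (H * H).
Hypothesis sqrtC : is_sqrt_in M (op_part (inverse T)) C.

(** For [f = T x] both sides are the product of [f] and [x]: the kernel part of [x] is orthogonal to
    [f]. An arbitrary [C] is allowed because [form_rel] uses an [xget] choice. *)
Lemma inverse_form x h f : B (x, h) -> B (h, f) ->
  exists2 w, C (f, w) & rdot w w = rdot h h.
Proof.
move=> Bxh Bhf; have [x' Mx' Tx] := range_split x.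
have Txf := sqrtW Bxh Bhf.
have [_ _ saC CC] := sqrtC; have CP := selfadjoint_inP saC.
have : op_part (inverse T) (f, x').
  apply/op_part_inverseP; split=> //.
  have : T (x - (x - x'), f - 0).
    exact (subspaceB linT Txf Tx).
  by rewrite subKr subr0.
rewrite -CC => -[w /= Cfw /CP[/(_ _ Cfw) /= ww _ _]].
exists w => //; rewrite /rdot ww (sqrt_sym Bxh Bhf).
rewrite -[in RHS](subrK x' x) dotDl dotC.
have /kerP -> := Tx; last by apply: sub_hclosure; exists (f, x).
by rewrite add0r Re_conjC.
Qed.

(** Values of [C] are approximated by vectors [w.2] in the domain of [C]. There [u = C w.2]
    satisfies [T u = w.1], so the geometry of [h] and [w.2] is expressed through [u] and [B u]. *)
Lemma inverse_core f h : C (f, h) -> forall e : R, 0 < e ->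
  exists (u b : H) (w : H * H), [/\ T (u, w.1), B (u, b), C w & 
    [/\ hdot h w.2 = hdot f u, rdot w.2 w.2 = rdot b b & hnorm (h - w.2) < e]].
Proof.
move=> Cfh e e0; have [linC _ saC CC] := sqrtC; have CP := selfadjoint_inP saC.
have cC := selfadjoint_in_closed range_closed saC.
have [[g w] [Cgw [z /= hz]] lt] := gram_core linC cC Cfh e0.
have [_ /= Mg Mw] := (CP _).1 Cgw.
(* [C] is selfadjoint only inside [M], so the value [z] of the full adjoint has to be projected to
   [M]. *)
have [u Mu orth] := projection z range_subspace range_closed.
have Cwu : C (w, u).
  apply/CP; split=> // q Cq /=; have /= -> := hz _ Cq; apply/subr0_eq.
  by rewrite -dotBr; apply/dot_eq0C/orth; have [] := (CP q).1 Cq.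
have : op_part (inverse T) (g, u) by rewrite -CC; exists w.
move=> /op_part_inverseP [Tug _]; have [b Bub Bbg] := sqrtV Tug.
exists u, b, (g, w); split=> //=; split; last 1 first.
- exact: le_lt_trans (hnorm_snd_le ((f, h) - (g, w))) lt.
- by have [/(_ _ Cfh)] := (CP _).1 Cwu.
- have [/(_ _ Cgw) /= ww _ _] := (CP _).1 Cwu.
  by rewrite /rdot ww (sqrt_sym Bub Bbg) dotC Re_conjC.
Qed.

End AnySqrt.
End Inverse.
End SqrtIn.

(** * Coupling through a boundary triplet *)

Lemma orth_dense (R : realType) (H : hilbertType R) (M : set H) u :
  hdense M -> (forall v, M v -> hdot u v = 0) -> u = 0.
Proof.
move=> dM h; apply: rdot_eq0; rewrite /rdot (orth_hclosure h) //.
by have -> : hclosure M = setT by [].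
Qed.

Lemma domP (R : realType) (H K : hilbertType R) (T : set (H * K)) u :
  dom T u -> exists b, T (u, b).
Proof. by move=> [[x b] /= Tx <-]; exists b. Qed.

Section Triplet.
Context {R : realType} {H K : hilbertType R}.
Variables (S S0 S1 : set (H * H)) (Gamma0 Gamma1 : H -> K).
Hypotheses (Sdense : hdense (dom S)) (SS0 : S `<=` S0) (SS1 : S `<=` S1).
Hypothesis S01 : closed_restriction (form_op S0) (form_op S1).
Hypothesis triplet : boundary_triplet S S0 S1 Gamma0 Gamma1.

Let B0 := sqrt_op S0.
Let B1 := sqrt_op S1.
Let A := calA S S0 S1 Gamma0 Gamma1.

Lemma Gamma0_surj g : exists2 p, B1 p & Gamma0 p.1 = g.
Proof.
have [[_ _ _ sG] _ _] := triplet; have : setT g by [].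
by rewrite -sG => -[v [p Bp <-] <-]; exists p.
Qed.

Lemma sqrtB1 : is_sqrt_in setT S1 B1.
Proof.
have [p Bp _] := Gamma0_surj 0.
by apply: (sqrt_op_inhabited (u := p.1)); exists p.
Qed.

Lemma kerG v : dom B1 v /\ Gamma0 v = 0 <-> dom B0 v.
Proof.
have [[_ _ kG _] _ _] := triplet.
by move: kG => /(congr1 (fun M : set H => M v)) /= ->.
Qed.

Lemma sqrtB0 : is_sqrt_in setT S0 B0.
Proof.
have [p Bp Gp] := Gamma0_surj 0.
by apply: (sqrt_op_inhabited (u := p.1)); apply/kerG; split=> //; exists p.
Qed.

Lemma linB1 : linear_operator B1. Proof. by case: sqrtB1. Qed.
Lemma linB0 : linear_operator B0. Proof. by case: sqrtB0. Qed.

Lemma closedB1 : hclosure B1 `<=` B1.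
Proof. by have [_ _ sa _] := sqrtB1; exact: (selfadjoint_in_closed _ sa). Qed.

Lemma Gamma0_lin a u v : dom B1 u -> dom B1 v ->
  Gamma0 (a *: u + v) = a *: Gamma0 u + Gamma0 v.
Proof. by have [[lG _ _ _] _ _] := triplet; exact: lG. Qed.

Lemma Gamma0_0 : Gamma0 0 = 0.
Proof.
have := Gamma0_lin (-1) (u := 0) (v := 0); rewrite !scaleN1r oppr0 addr0 addNr.
by apply; exists (0, 0) => //; exact: linB1.1.1.
Qed.

Lemma dom0_ker v : dom S0 v -> exists2 b, B1 (v, b) & Gamma0 v = 0.
Proof.
move=> [[x f] /= Sxf <-]; have [b Bb _] := sqrtV sqrtB0 Sxf.
have /kerG[/domP[c Bc] ?] : dom B0 x by exists (x, b).
by exists c.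
Qed.

Lemma form01 u v b c b' c' : B0 (u, b) -> B0 (v, c) ->
  B1 (u, b') -> B1 (v, c') -> hdot b c = hdot b' c'.
Proof.
move=> Bb Bc Bb' Bc'; have [_ /(_ u v)] := S01; rewrite /= -/B0 -/B1.
rewrite (valueE linB0 Bb) (valueE linB0 Bc).
rewrite (valueE linB1 Bb') (valueE linB1 Bc').
by apply; [exists (u, b)|exists (v, c)].
Qed.

(** The norm of [D[S1]] is the graph norm of [B1], so continuity of [Gamma0] becomes continuity on
    that graph. *)
Lemma form_norm1 p q : B1 p -> B1 q -> 
  form_norm (form_op S1) (p.1 - q.1) = hnorm (p - q).
Proof.
move=> Bp Bq; rewrite /form_norm /form_dot /= -/B1.
have Bpq : B1 (p.1 - q.1, p.2 - q.2) := subspaceB linB1.1 Bp Bq.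
by rewrite (valueE linB1 Bpq) addrC.
Qed.

Lemma Gamma0_cont p (e : R) : B1 p -> 0 < e -> exists2 d : R, 0 < d &
  forall q, B1 q -> hnorm (q - p) < d -> hnorm (Gamma0 q.1 - Gamma0 p.1) < e.
Proof.
move=> Bp e0; have [[_ cG _ _] _ _] := triplet.
have [|d d0 hd] := cG p.1 _ e e0; first by exists p.
exists d => // q Bq; rewrite -form_norm1 // => lt; apply: hd => //.
by exists q.
Qed.

Lemma triplet_form u v b c : calL S0 S1 u -> B1 (u, b) -> B1 (v, c) ->
  hdot b c = hdot (value (adjoint S) u) v - hdot (Gamma1 u) (Gamma0 v).
Proof.
move=> Lu Bb Bc; have [_ _ <- //] := triplet; last by exists (v, c).
by rewrite /= -/B1 (valueE linB1 Bb) (valueE linB1 Bc).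
Qed.

Lemma calL_dom u : calL S0 S1 u -> dom B1 u.
Proof.
move=> [u0 /dom0_ker[b Bb _] [w [/domP[c Bc] _] ->]].
exists (u0 + w, b + c) => //; exact (subspaceD linB1.1 Bb Bc).
Qed.

(** * The closed operator [couple] and the identity with [calA] *)

Definition couple : set ((H * K) * H) :=
  [set p | B1 (p.1.1, p.2) /\ p.1.2 = Gamma0 p.1.1].

Lemma couple_lin : linear_operator couple.
Proof.
split; first split; first by split; [exact: linB1.1.1 | rewrite /= Gamma0_0].
  move=> a p q [Bp Gp] [Bq Gq]; split; first exact: (linB1.1.2 a _ _ Bp Bq).
  rewrite /= Gp Gq Gamma0_lin //; first by exists (p.1.1, p.2).
  by exists (q.1.1, q.2).
apply/seteqP; split=> [z [/= Bz _]|_ ->].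
  by apply: (operator_uniq linB1 Bz); exact: linB1.1.1.
by split; [exact: linB1.1.1 | rewrite /= Gamma0_0].
Qed.

Lemma couple_closed : hclosure couple `<=` couple.
Proof.
have proj_le (p q : (H * K) * H) :
    hnorm ((p.1.1, p.2) - (q.1.1, q.2)) <= hnorm (p - q).
  apply: ler_hnorm (hnorm_ge0 _) _; rewrite -hnorm_sqr.
  by rewrite !hnorm_pair_sqr /= lerD2r lerDl sqr_ge0.
move=> p hp; have Bp : B1 (p.1.1, p.2).
  apply: closedB1 => e e0; have [q [Bq _] lt] := hp e e0.
  by exists (q.1.1, q.2) => //; apply: le_lt_trans lt.
split=> //; apply/subr0_eq/hnorm0_eq0/eqP; rewrite eq_le hnorm_ge0 andbT.
apply/ler_addgt0Pl => e e0; rewrite addr0.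
have e2 : 0 < e / 2 by rewrite divr_gt0.
have [d d0 hd] := Gamma0_cont Bp e2.
have [|q [Bq Gq]] := hp (Num.min d (e / 2)); first by rewrite lt_min d0.
rewrite lt_min => /andP[lt1 lt2].
apply: le_trans (ler_hnorm_sub (Gamma0 q.1.1) _ _) _; rewrite [e]splitr.
apply: lerD; last first.
  apply/ltW/(hd (q.1.1, q.2)) => //; rewrite hnorm_subC.
  exact: le_lt_trans (proj_le _ _) lt1.
rewrite -Gq; apply/ltW; apply: le_lt_trans lt2.
exact: le_trans (hnorm_snd_le (p - q).1) (hnorm_fst_le (p - q)).
Qed.

(** This density makes [couple^*], hence [calA], single-valued: vectors of [dom S], on which
    [Gamma0] vanishes, remove [f], and surjectivity of [Gamma0] removes [g]. *)
Lemma couple_dense z : (forall x b, B1 (x, b) ->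
  hdot x z.1 + hdot (Gamma0 x) z.2 = 0) -> z = 0.
Proof.
case: z => f g /= h.
have f0 : f = 0.
  apply: (orth_dense Sdense) => s [[s' t] /= Sst <-].
  have [|b Bb G0] := @dom0_ker s'; first by exists (s', t) => //; exact: SS0.
  by apply: dot_eq0C; have := h _ _ Bb; rewrite G0 dot0l addr0.
have [[x b] Bx Gx] := Gamma0_surj g.
have := h _ _ Bx; rewrite f0 dot0r add0r [Gamma0 x]Gx => gg.
by congr pair; apply: rdot_eq0; rewrite /rdot gg.
Qed.

Lemma adjointS_lin : linear_operator (adjoint S).
Proof.
split; first exact: adjoint_subspace.
apply/seteqP; split=> [w hw|_ ->]; last exact: (adjoint_subspace S).1.
apply: (orth_dense Sdense) => s [q Sq <-]; apply: dot_eq0C.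
by have := hw _ Sq; rewrite /= dot0r.
Qed.

(** Orthogonal decomposition of [D[S1]] along [D[S0]], done in the graph of [B1]; the part over
    [D[S0]] is closed as a slice of [couple]. *)
Lemma ker_decomposition v y : B1 (v, y) -> exists v0 c0, [/\ B1 (v0, c0),
  dom B0 v0 & forall x c, dom B0 x -> B1 (x, c) ->
    hdot (v - v0) x + hdot (y - c0) c = 0].
Proof.
move=> Bv; pose G := [set p | couple ((p.1, 0), p.2)].
have hG : subspace G.
  have [hc _] := couple_lin; split; first exact: hc.1.
  move=> a p q Gp Gq; have := hc.2 a _ _ Gp Gq.
  by rewrite /G /= /couple /= scaler0 addr0.
have cG : hclosure G `<=` G.
  move=> p hp; apply: couple_closed => e e0; have [q Gq lt] := hp e e0.
  exists ((q.1, 0), q.2) => //.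
  apply: le_lt_trans lt; apply: ler_hnorm (hnorm_ge0 _) _; rewrite -!hnorm_sqr.
  by rewrite !hnorm_pair_sqr /= subr0 hnorm0 expr0n addr0.
have [[v0 c0] [Bm Gm] orth] := projection (v, y) hG cG.
exists v0, c0; split=> //.
  by apply/kerG; split=> //; exists (v0, c0).
move=> x c /kerG[_ Gx] Bx; have := orth (x, c); rewrite dot_pair /=; apply.
by split.
Qed.

(** One inclusion is the Green identity. For the other, the adjoint equation is tested on [D[S0]] to
    place [v] in [calL], on [dom S] to get [f = S^* v], and on all of [D[S1]] to get
    [g = - Gamma1 v]. *)
Lemma couple_gram : gram couple = A.
Proof.
apply/seteqP; split; last first.
  move=> _ [u Lu <-]; have [b Bb] := domP (calL_dom Lu).
  exists b; first by split.
  move=> [[w k] c] [/= Bc ->]; rewrite dot_pair /= dotNr.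
  by rewrite dotC (triplet_form Lu Bb Bc) rmorphB /= -!dotC.
move=> [[v k] [f g]] [y [/= Bv ->] hy].
have {}hy w c : B1 (w, c) -> hdot c y = hdot w f + hdot (Gamma0 w) g.
  by move=> Bw; apply: (hy ((w, Gamma0 w), c)); split.
have [v0 [c0 [Bv0 D0v0 orth]]] := ker_decomposition Bv.
have [b0 Bb0] := domP D0v0.
(* It follows that [S0 v0 = f + (v - v0)], in accordance with [S^*] acting as [-1] on the complement
   of [D[S0]]. *)
have B0w : B0 (b0, f + (v - v0)).
  have [_ _ /selfadjoint_inT <- _] := sqrtB0 => -[x bx] /= Bx.
  have D0x : dom B0 x by exists (x, bx).
  have [/domP[cx Bcx] Gx] := (kerG x).2 D0x.
  rewrite (form01 Bx Bb0 Bcx Bv0) dotDr.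
  rewrite -[c0](subKr y) [LHS]dotBr (hy _ _ Bcx) Gx dot0l addr0; congr (_ + _).
  have := dot_eq0C (u := (v - v0, y - c0)) (v := (x, cx)) (orth _ _ D0x Bcx).
  rewrite dot_pair /= => /eqP; rewrite addrC addr_eq0 => /eqP ->.
  by rewrite opprK.
have Lv : calL S0 S1 v.
  exists v0.
    by exists (v0, f + (v - v0)) => //; exact (sqrtW sqrtB0 Bb0 B0w).
  exists (v - v0); last by rewrite addrC subrK.
  have Bw : B1 (v - v0, y - c0) := subspaceB linB1.1 Bv Bv0.
  split; first by exists (v - v0, y - c0).
  move=> x D0x; have [/domP[cx Bcx] Gx] := (kerG x).2 D0x.
  rewrite /form_dot /= -/B1 (valueE linB1 Bw) (valueE linB1 Bcx) addrC.
  exact: orth.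
have vf : value (adjoint S) v = f.
  apply: (valueE adjointS_lin) => -[s t] /= Sst.
  have [b Bsb Bbt] := sqrtV sqrtB1 (SS1 Sst).
  rewrite (sqrt_sym sqrtB1 Bbt Bv) (hy _ _ Bsb).
  have [|_ _ ->] := @dom0_ker s; first by exists (s, t) => //; exact: SS0.
  by rewrite dot0l addr0.
exists v => //; rewrite vf; congr (_, (_, _)); apply/esym/eqP.
rewrite -subr_eq0 opprK; apply/eqP.
(* The vector to be shown zero is itself a value of [Gamma0], so it can be tested against itself. *)
have [[x b] Bx Gx] := Gamma0_surj (g + Gamma1 v).
apply: rdot_eq0; rewrite /rdot -{1}Gx.
have := triplet_form Lv Bv Bx; rewrite dotC (hy _ _ Bx) vf rmorphD /= -!dotC.
move=> /addrI h; rewrite dotC dotDl h.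
by rewrite addNr conjC0.
Qed.

Lemma calA_selfadjoint : nonneg_selfadjoint_operator A.
Proof.
have [linQ closedQ] := (couple_lin, couple_closed).
rewrite -couple_gram; split; last exact: gram_selfadjoint linQ.1 closedQ.
  split; first exact: gram_subspace linQ.1.
  apply/seteqP; split=> [z [y /= Qy hz]|_ ->]; last first.
    exact: (gram_subspace linQ.1).1.
  have y0 : y = 0 by apply: (operator_uniq linQ Qy); exact: linQ.1.1.
  apply: couple_dense => x b Bx; have /= := hz ((x, Gamma0 x), b).
  by rewrite y0 dot0r dot_pair /= => <- //; split.
exact: gram_nonneg.
Qed.

Lemma calA_extends p : S p -> A ((p.1, 0), (p.2, 0)).
Proof.
case: p => s t Sst /=; have D0s : dom S0 s by exists (s, t) => //; exact: SS0.
have [b Bb G0] := dom0_ker D0s.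
rewrite -couple_gram; exists b; first by split; rewrite //= G0.
move=> [[x k] c] [/= Bx _]; rewrite dot_pair /= dot0r addr0.
have [b' Bb' Bt] := sqrtV sqrtB1 (SS1 Sst).
by rewrite (operator_uniq linB1 Bb Bb') (sqrt_sym sqrtB1 Bx Bt).
Qed.

(** * The form of [calA] *)

Lemma sqrtA : is_sqrt_in setT A (sqrt_op A).
Proof.
have [linA nnegA saA] := calA_selfadjoint.
have [|f|B hB] := @sqrt_exists _ _ A linA _ nnegA; last exact: sqrt_inP hB.
  by rewrite /symmetric_relation -saA.
by rewrite -couple_gram; apply: gram_surj couple_closed _; exact: couple_lin.1.
Qed.

Lemma sqrtA_gram : gram (sqrt_op A) = A.
Proof.
have [_ _ /selfadjoint_inT sa {2}<-] := sqrtA.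
by rewrite /gram sa.
Qed.

Lemma sqrtA_closed : hclosure (sqrt_op A) `<=` sqrt_op A.
Proof. by have [_ _ sa _] := sqrtA; exact: (selfadjoint_in_closed _ sa). Qed.

Lemma sqrtA_couple x b : B1 (x, b) ->
  exists2 b', sqrt_op A ((x, Gamma0 x), b') & hnorm b' = hnorm b.
Proof.
have [linA _ _ _] := sqrtA; move=> Bx.
apply: (gram_form_le couple_lin couple_closed linA.1 sqrtA_closed) => //.
by rewrite couple_gram sqrtA_gram.
Qed.

Lemma couple_sqrtA p b' : sqrt_op A (p, b') ->
  exists2 b, B1 (p.1, b) & p.2 = Gamma0 p.1.
Proof.
have [linA _ _ _] := sqrtA; move=> Ap.
have [linQ _] := couple_lin.
have [|b [Bb Gb] _] := gram_form_le linA sqrtA_closed linQ couple_closed _ Ap.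
  by rewrite couple_gram sqrtA_gram.
by exists b.
Qed.

Lemma qdom_calA :
  qdom (form_op A) = [set (v, Gamma0 v) | v in qdom (form_op S1)].
Proof.
apply/seteqP; split=> [[v k] /domP[b /couple_sqrtA[c Bc /= ->]]|_ [v Dv <-]].
  by exists v => //; exists (v, c).
have [b Bb] := domP Dv; have [b' Ab' _] := sqrtA_couple Bb.
by exists (v, Gamma0 v, b').
Qed.

Lemma qval_calA v : qdom (form_op S1) v ->
  qval (form_op A) (v, Gamma0 v) (v, Gamma0 v) = qval (form_op S1) v v.
Proof.
move=> /domP[b Bb]; have [b' Ab' nb] := sqrtA_couple Bb.
have [linA _ _ _] := sqrtA.
by rewrite /= (valueE linA Ab') (valueE linB1 Bb) !dot_self nb.
Qed.

Lemma dom_sqrtA_ker : dom (sqrt_op A) `&` [set p | p.1 = 0] = [set 0].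
Proof.
have [linA _ _ _] := sqrtA.
apply/seteqP; split=> [[v k] [/domP[b /couple_sqrtA[c Bc /= ->]] /= v0]|_ ->].
  by rewrite v0 Gamma0_0.
by split=> //; exists 0 => //; exact: linA.1.1.
Qed.

(** * Consequences of the hypothesis on the inverse forms *)

Section Inverse.
Hypotheses (S0sa : nonneg_selfadjoint_operator S0).
Hypotheses (S1sa : nonneg_selfadjoint_operator S1).
Hypothesis S10inv :
  closed_restriction (form_rel (inverse S1)) (form_rel (inverse S0)).

Lemma range_sqrt_approx x h f : B1 (x, h) -> B1 (h, f) -> forall e : R, 0 < e ->
  exists u b, [/\ dom S0 u, B1 (u, b) & hnorm (h - b) < e].
Proof.
move=> Bxh Bhf e e0.
have [[linS1 _] _ sa1] := S1sa; have [[linS0 _] _ sa0] := S0sa.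
have [C1' hC1'] := inverse_sqrt_exists sa1 linS1 sqrtB1.
have {C1' hC1'} sC1 := sqrt_inP hC1'.
have [C0' hC0'] := inverse_sqrt_exists sa0 linS0 sqrtB0.
have {C0' hC0'} sC0 := sqrt_inP hC0'.
have [w C1w ww] := inverse_form sa1 linS1 sqrtB1 sC1 Bxh Bhf.
have [sub agree] := S10inv.
have D1f : dom (sqrt_in (hclosure (dom (inverse S1))) (op_part (inverse S1))) f.
  by exists (f, w).
have [h' C0h'] := domP (sub f D1f).
have linC1 : linear_operator _ := let: And4 l _ _ _ := sC1 in l.
have linC0 : linear_operator _ := let: And4 l _ _ _ := sC0 in l.
have hh' : rdot h' h' = rdot h h.
  have := agree f f D1f D1f; rewrite /= (valueE linC1 C1w) (valueE linC0 C0h').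
  by move=> E; rewrite -ww /rdot E.
have [u [b0 [w' [S0u B0u C0w' [hw ww' lt]]]]] :=
  inverse_core sa0 linS0 sqrtB0 sC0 C0h' e0.
have D0u : dom S0 u by exists (u, w'.1).
have [b1 B1u _] := dom0_ker D0u.
exists u, b1; split=> //; apply: le_lt_trans lt.
(* The expansions of [|h - b1|^2] and [|h' - w'.2|^2] agree term by term, both cross terms coming
   from the product of [f] and [u]. *)
apply: ler_hnorm (hnorm_ge0 _) _; rewrite hnorm_sqrB -hnorm_sqr hnorm_sqrB.
rewrite !hnorm_sqr hh' ww' /rdot hw (form01 B0u B0u B1u B1u).
by rewrite -(sqrt_sym sqrtB1 Bhf B1u).
Qed.

(** By the core property [B1 v] is first replaced by some [h = B1 x] with [x] in [dom S1], the case
    covered by [range_sqrt_approx]. *)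
Lemma form_approx v : dom B1 v -> forall e : R, 0 < e ->
  exists u b, [/\ dom S0 u, B1 (v - u, b) & hnorm b < e].
Proof.
move=> /domP[y By] e e0; have e2 : 0 < e / 2 by rewrite divr_gt0.
have [_ _ /selfadjoint_inT sa _] := sqrtB1.
have [[x h] [Bxh [f hf]] lt] := gram_core linB1 closedB1 By e2.
have Bhf : B1 (h, f) by rewrite -sa.
have [u [b [D0u Bu lt']]] := range_sqrt_approx Bxh Bhf e2.
exists u, (y - b); split=> //; first exact (subspaceB linB1.1 By Bu).
apply: le_lt_trans (ler_hnorm_sub h _ _) _; rewrite [e]splitr ltrD //.
exact: le_lt_trans (hnorm_snd_le ((v, y) - (x, h))) lt.
Qed.

Lemma sqrtA_approx v : dom B1 v -> forall e : R, 0 < e -> exists2 u, dom S0 u &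
  exists2 c, sqrt_op A ((v, Gamma0 v) - (u, 0), c) & hnorm c < e.
Proof.
move=> Dv e e0; have [u [b [D0u Bb lt]]] := form_approx Dv e0.
exists u => //; have [c Ac nc] := sqrtA_couple Bb; exists c; last by rewrite nc.
suff -> : (v, Gamma0 v) - (u, 0) = (v - u, Gamma0 (v - u)) by [].
have [b' Bu Gu] := dom0_ker D0u.
have -> : Gamma0 (v - u) = Gamma0 v - 0.
  rewrite -[- u]scaleN1r addrC Gamma0_lin //; last by exists (u, b').
  by rewrite Gu scaler0 add0r subr0.
by [].
Qed.

Lemma inf_calA v : qdom (form_op S1) v ->
  ereal_inf [set (complex.Re (qval (form_op A)
                    ((v, Gamma0 v) - (u, 0)) ((v, Gamma0 v) - (u, 0))))%:E
            | u in dom S0] = 0%E.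
Proof.
move=> Dv; have [linA _ _ _] := sqrtA.
apply/eqP; rewrite eq_le; apply/andP; split.
  apply/lee_addgt0Pr => e e0; rewrite add0e.
  have [|u D0u [c Ac lt]] := sqrtA_approx Dv (e := Num.sqrt e).
    by rewrite sqrtr_gt0.
  apply: ge_ereal_inf; eexists; first by exists u.
  rewrite /= (valueE linA Ac) lee_fin.
  rewrite -/(rdot c c) -hnorm_sqr -(sqr_sqrtr (ltW e0)).
  by rewrite ler_pXn2r ?nnegrE ?hnorm_ge0 ?sqrtr_ge0 // ltW.
apply/ereal_infP => _ [u _ <-]; rewrite lee_fin; exact: rdot_ge0.
Qed.

(** If [(0, g)] is the value of the root at [p] and [Gamma0 x = g], then [|g|^2] is the product of
    [p] with the value of the root at [(x - u, g)], and suitable [u] make that value arbitrarily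
    small. *)
Lemma ran_sqrtA_ker : ran (sqrt_op A) `&` [set p | p.1 = 0] = [set 0].
Proof.
have sA := sqrtA; have [linA _ _ _] := sA.
apply/seteqP; split=> [_ [[[p [f g]] /= Apq <-] /= f0]|_ ->]; last first.
  by split=> //; exists 0 => //; exact: linA.1.1.
have [[x b] Bx Gx] := Gamma0_surj g; rewrite /= in Gx; rewrite {}f0 in Apq *.
suff g0 : rdot g g <= 0.
  by rewrite (@rdot_eq0 _ _ g) //; apply/eqP; rewrite eq_le g0 rdot_ge0.
apply/ler_addgt0Pl => e e0; rewrite addr0.
have p1 : 0 < 1 + hnorm p by rewrite ltr_wpDr ?hnorm_ge0.
have [|u _ [c Ac lt]] := sqrtA_approx (v := x) _ (divr_gt0 e0 p1).
  by exists (x, b).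
have := sqrt_sym sA Apq Ac; rewrite dot_pair /= dot0l add0r subr0 Gx => gg.
rewrite /rdot gg; apply: le_trans (ler_norm _) _.
apply: le_trans (rdot_le _ _) _.
move: lt; rewrite ltr_pdivlMr // => lt.
by have := hnorm_ge0 c; have := hnorm_ge0 p; nra.
Qed.

End Inverse.

End Triplet.

Theorem theorem7p13 (R : realType) (H K : hilbertType R)
    (S S0 S1 : set (H * H)) (Gamma0 Gamma1 : H -> K)
    (Hsep : separable H)
    (Sop : linear_operator S) (Sdense : hdense (dom S))
    (Ssym : symmetric_relation S) (Snneg : nonnegative S)
    (S0sa : nonneg_selfadjoint_operator S0) (SS0 : S `<=` S0)
    (S1sa : nonneg_selfadjoint_operator S1) (SS1 : S `<=` S1)
    (domS : dom S1 `&` dom S0 = dom S)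
    (S01 : closed_restriction (form_op S0) (form_op S1))
    (triplet : boundary_triplet S S0 S1 Gamma0 Gamma1) :
  let A : set ((H * K) * (H * K)) := calA S S0 S1 Gamma0 Gamma1 in
  [/\ nonneg_selfadjoint_operator A,
      [set ((p.1, 0), (p.2, 0)) | p in S] `<=` A,
      qdom (form_op A) = [set (v, Gamma0 v) | v in qdom (form_op S1)],
      forall v, qdom (form_op S1) v ->
        qval (form_op A) (v, Gamma0 v) (v, Gamma0 v) = qval (form_op S1) v v
    & dom (sqrt_op A) `&` [set p | p.1 = 0] = [set 0]] /\
  (S0 `&` S1 = S ->
   closed_restriction (form_op S0) (form_op S1) ->
   closed_restriction (form_rel (inverse S1)) (form_rel (inverse S0)) ->
   (forall v, qdom (form_op S1) v ->
      ereal_inf [set (complex.Re (qval (form_op A)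
                        ((v, Gamma0 v) - (u, 0)) ((v, Gamma0 v) - (u, 0))))%:E
                | u in dom S0] = 0%E) /\
   ran (sqrt_op A) `&` [set p | p.1 = 0] = [set 0]).
Proof.
move=> A; split.
  split.
  - exact: (calA_selfadjoint Sdense SS0 SS1 S01 triplet).
  - by move=> _ [p Sp <-]; exact: (calA_extends Sdense SS0 SS1 S01 triplet).
  - exact: (qdom_calA Sdense SS0 SS1 S01 triplet).
  - exact: (qval_calA Sdense SS0 SS1 S01 triplet).
  - exact: (dom_sqrtA_ker Sdense SS0 SS1 S01 triplet).
move=> _ _ S10inv; split.
  exact: (inf_calA Sdense SS0 SS1 S01 triplet S0sa S1sa S10inv).
exact: (ran_sqrtA_ker Sdense SS0 SS1 S01 triplet S0sa S1sa S10inv).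
Qed.
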